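(* Let $G$ be a finitely generated group and $K$ a computable field. The Bounded Width Diophantine Problem in the group algebra $K(G)$ is decidable if and only if the Diophantine problems in $K$ and in $G$ are both decidable.
   Context: The Diophantine problem in $K$ (respectively in $G$) asks whether there is an algorithm deciding, given a finite system of polynomial equations with coefficients in $K$ (respectively of group equations with constants in $G$), whether it has a solution in $K$ (respectively in $G$). Every non-zero $f\in K(G)$ can be written, uniquely up to permutation of summands, in normal form $f=\sum_i\alpha_i g_i$ with $g_i\in G$ pairwise distinct and $\alpha_i\in K\setminus\{0\}$. The width of $f$ is the number of summands in its normal form (the zero element has width $0$). A solution $x\mapsto f_x$ ($x\in X$) in $K(G)$ of a finite system of equations, in a finite set $X$ of (non-commuting) variables and with coefficients in $K(G)$, has width at most $m$ if all the elements $f_x$ have width at most $m$. The Bounded Width Diophantine Problem in $K(G)$ is decidable if there is an algorithm which, given a finite system of equations in $K(G)$ and a number $m\in\mathbb{N}$, decides whether or not the system has a solution of width at most $m$ in $K(G)$, and if so finds one. Elements of $G$ are given as words in a finite generating set and their inverses. *)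

(* Defs.v *)
From HB Require Import structures.
From mathcomp Require Import all_boot all_order all_algebra.
From mathcomp Require finmap monalg mpoly.

Set Implicit Arguments.
Unset Strict Implicit.
Unset Printing Implicit Defensive.

Import GRing.Theory.

Local Open Scope ring_scope.

(* The total recursive functions: the least class of functions nat^n -> nat    *)
(* containing zero, successor and the projections, and closed under            *)
(* composition, primitive recursion and minimization of regular functions      *)
(* (those for which the search always terminates). The last constructor only   *)
(* makes the class extensional.                                                *)
Inductive recursive : forall n, (n.-tuple nat -> nat) -> Prop :=
| rec_zero : recursive (fun _ : 0.-tuple nat => 0%N)
| rec_succ : recursive (fun v : 1.-tuple nat => (thead v).+1)
| rec_proj n (i : 'I_n) : recursive (fun v : n.-tuple nat => tnth v i)
| rec_comp m n (f : m.-tuple nat -> nat) (g : 'I_m -> n.-tuple nat -> nat) :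
    recursive f -> (forall i, recursive (g i)) ->
    recursive (fun v : n.-tuple nat => f [tuple g i v | i < m])
| rec_prim n (f : n.-tuple nat -> nat) (g : n.+2.-tuple nat -> nat) :
    recursive f -> recursive g ->
    recursive (fun v : n.+1.-tuple nat =>
      iteri (thead v) (fun i r => g [tuple of i :: r :: behead v])
            (f [tuple of behead v]))
| rec_mu n (f : n.+1.-tuple nat -> nat)
    (ex0 : forall v : n.-tuple nat, exists y, f [tuple of y :: v] == 0%N) :
    recursive f -> recursive (fun v : n.-tuple nat => ex_minn (ex0 v))
| rec_ext n (f g : n.-tuple nat -> nat) :
    f =1 g -> recursive f -> recursive g.

Definition computable1 (f : nat -> nat) : Prop :=
  recursive (fun v : 1.-tuple nat => f (thead v)).

Definition computable2 (f : nat -> nat -> nat) : Prop :=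
  recursive (fun v : 2.-tuple nat => f (tnth v ord0) (tnth v ord_max)).

(* A computable field in the sense of Rabin is a field with a coding by        *)
(* natural numbers, i.e. an injection with recursive image that transports     *)
(* the operations to recursive ones. Negation and inversion are then           *)
(* recursive as well, by unbounded search.                                     *)
Record computable_coding (K : fieldType) (c : K -> nat) : Prop := {
  coding_inj : injective c;
  coding_im : exists2 chi, computable1 chi &
                forall n, chi n = 1%N <-> exists x, c x = n;
  coding_add : exists2 add, computable2 add &
                 forall x y, add (c x) (c y) = c (x + y);
  coding_mul : exists2 mul, computable2 mul &
                 forall x y, mul (c x) (c y) = c (x * y)
}.

(* [CodeSeq.code] is the library's bijection from seq nat to nat. *)
Definition code_pair (a b : nat) : nat := CodeSeq.code [:: a; b].

Definition code_seq (T : Type) (c : T -> nat) (s : seq T) : nat :=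
  CodeSeq.code [seq c x | x <- s].

Definition code_sum (A B : Type) (cA : A -> nat) (cB : B -> nat) (u : A + B) :=
  match u with inl a => code_pair 0 (cA a) | inr b => code_pair 1 (cB b) end.

Section FieldDiophantine.
(* The notations of [mpoly] clash with those of [monalg]. *)
Import mpoly.
Context (K : fieldType).

(* A polynomial in k commuting variables is given as a list of terms           *)
(* (coefficient, exponents), not necessarily reduced.                          *)
Definition mpoly_terms (k : nat) := seq (K * 'X_{1..k}).

Definition mpoly_of_terms k (p : mpoly_terms k) : {mpoly K[k]} :=
  \sum_(t <- p) t.1 *: 'X_[t.2].

Definition field_solution k (S : seq (mpoly_terms k)) (x : 'I_k -> K) : Prop :=
  forall p, p \in S -> (mpoly_of_terms p).@[x] = 0.

Definition code_field_system (c : K -> nat) k (S : seq (mpoly_terms k)) : nat :=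
  code_pair k
    (code_seq (code_seq (fun t : K * 'X_{1..k} =>
       code_pair (c t.1) (CodeSeq.code t.2))) S).

Definition field_diophantine_decidable (c : K -> nat) : Prop :=
  exists2 f, computable1 f &
    forall k (S : seq (mpoly_terms k)),
      f (code_field_system c S) = 1%N <-> exists x, field_solution S x.

End FieldDiophantine.

(* Words in n letters and their inverses; [(i, true)] is the inverse of the    *)
(* i-th letter.                                                                *)
Definition word (n : nat) := seq ('I_n * bool).

Definition signed (G : groupType) (g : G) (b : bool) : G :=
  if b then g^-1%g else g.

Definition word_eval (G : groupType) n (s : n.-tuple G) (w : word n) : G :=
  (\prod_(l <- w) signed (tnth s l.1) l.2)%g.

Definition generates (G : groupType) n (s : n.-tuple G) : Prop :=
  forall g : G, exists w : word n, word_eval s w = g.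

Definition code_letter n (l : 'I_n * bool) : nat := code_pair l.1 l.2.

Definition code_word n (w : word n) : nat := code_seq (@code_letter n) w.

Import finmap monalg.

(* [{malg R[G]}] is the free R-module on the set G (finitely supported         *)
(* functions). The library gives it a ring structure only for monoids without  *)
(* non-trivial units, hence the alias, which carries the convolution product.  *)
Definition galg (R : nzRingType) (G : groupType) := {malg R[G]}.

HB.instance Definition _ (R : nzRingType) (G : groupType) :=
  GRing.Zmodule.on (galg R G).

Section GroupAlgebra.
Context (R : nzRingType) (G : groupType).
Implicit Types f g h : {malg R[G]}.
Local Open Scope fset_scope.

Definition gaone : {malg R[G]} := << 1%g >>.

Definition gamul f g : {malg R[G]} :=
  \sum_(x <- msupp f) \sum_(y <- msupp g) << f@_x * g@_y *g (x * y)%g >>.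

Lemma gamulw (d1 d2 : {fset G}) f g : msupp f `<=` d1 -> msupp g `<=` d2 ->
  gamul f g =
    \sum_(x <- d1) \sum_(y <- d2) << f@_x * g@_y *g (x * y)%g >>.
Proof.
move=> le_d1 le_d2; rewrite /gamul (big_fset_incl _ le_d1) /=.
  apply/eq_bigr=> k1 _; apply/big_fset_incl => // k _ /mcoeff_outdom ->.
  by rewrite mulr0 monalgU0.
move=> k _ /mcoeff_outdom fk.
by rewrite big1 // => k' _; rewrite fk mul0r monalgU0.
Qed.

Lemma gamul0g : left_zero 0 gamul.
Proof. by move=> g; rewrite /gamul msupp0 big_seq_fset0. Qed.

Lemma gamulg0 : right_zero 0 gamul.
Proof.
by move=> g; rewrite /gamul big1 // => x _; rewrite msupp0 big_seq_fset0.
Qed.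

Lemma gamulUU a b x y :
  gamul << a *g x >> << b *g y >> = << a * b *g (x * y)%g >>.
Proof. by rewrite (gamulw msuppU_le msuppU_le) !big_seq_fset1 !mcoeffUU. Qed.

Lemma gamulDl : left_distributive gamul +%R.
Proof.
move=> f g h.
rewrite (gamulw (msuppD_le f g) (fsubset_refl _)).
rewrite (gamulw (fsubsetUl (msupp f) (msupp g)) (fsubset_refl (msupp h))).
rewrite (gamulw (fsubsetUr (msupp f) (msupp g)) (fsubset_refl (msupp h))).
rewrite -big_split /=; apply/eq_bigr=> x _.
rewrite -big_split /=; apply/eq_bigr=> y _.
by rewrite mcoeffD mulrDl monalgUD.
Qed.

Lemma gamulDr : right_distributive gamul +%R.
Proof.
move=> h f g.
rewrite (gamulw (fsubset_refl _) (msuppD_le f g)).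
rewrite (gamulw (fsubset_refl (msupp h)) (fsubsetUl (msupp f) (msupp g))).
rewrite (gamulw (fsubset_refl (msupp h)) (fsubsetUr (msupp f) (msupp g))).
rewrite -big_split /=; apply/eq_bigr=> x _.
rewrite -big_split /=; apply/eq_bigr=> y _.
by rewrite mcoeffD mulrDr monalgUD.
Qed.

Lemma gamul_suml (I : Type) (r : seq I) (F : I -> {malg R[G]}) g :
  gamul (\sum_(i <- r) F i) g = \sum_(i <- r) gamul (F i) g.
Proof.
exact: (big_morph (gamul^~ g) (fun _ _ => gamulDl _ _ _) (gamul0g _)).
Qed.

Lemma gamul_sumr (I : Type) (r : seq I) (F : I -> {malg R[G]}) g :
  gamul g (\sum_(i <- r) F i) = \sum_(i <- r) gamul g (F i).
Proof.
exact: (big_morph (gamul g) (fun _ _ => gamulDr _ _ _) (gamulg0 _)).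
Qed.

Lemma gamulA : associative gamul.
Proof.
move=> f g h; rewrite [f]monalgE !gamul_suml; apply/eq_bigr=> x _.
rewrite [g]monalgE [gamul (\sum_(k <- _) _) h]gamul_suml !gamul_sumr gamul_suml.
apply/eq_bigr=> y _; rewrite [h]monalgE !gamul_sumr; apply/eq_bigr=> z _.
by rewrite !gamulUU mulrA mulgA.
Qed.

Lemma gamul1g : left_id gaone gamul.
Proof.
move=> g; rewrite {1}[g]monalgE gamul_sumr [RHS]monalgE.
by apply/eq_bigr=> x _; rewrite gamulUU mul1r mul1g.
Qed.

Lemma gamulg1 : right_id gaone gamul.
Proof.
move=> g; rewrite {1}[g]monalgE gamul_suml [RHS]monalgE.
by apply/eq_bigr=> x _; rewrite gamulUU mulr1 mulg1.
Qed.

Lemma gaone_neq0 : gaone != 0.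
Proof. by rewrite monalgU_eq0 oner_eq0. Qed.

HB.instance Definition _ := GRing.Zmodule_isNzRing.Build (galg R G)
  gamulA gamul1g gamulg1 gamulDl gamulDr gaone_neq0.

End GroupAlgebra.

Definition width (R : nzRingType) (G : groupType) (f : galg R G) : nat :=
  #|` msupp f|.

(* As inputs and outputs of algorithms, elements of K(G) are given as formal   *)
(* sums of scalars times words.                                                *)
Definition galg_expr (K : fieldType) n := seq (K * word n).

Definition galg_eval (K : fieldType) (G : groupType) n (s : n.-tuple G)
    (a : galg_expr K n) : galg K G :=
  \sum_(t <- a) << t.1 *g word_eval s t.2 >>.

Definition code_galg (K : fieldType) (c : K -> nat) n (a : galg_expr K n) :=
  code_seq (fun t => code_pair (c t.1) (code_word t.2)) a.

(* An equation w = 1 is given as the list w of its   *)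
(* factors, which are variables, inverses of variables, and constants, the     *)
(* latter given as words in the generators.                                    *)
Definition group_eqn n k := seq ('I_k * bool + word n).

Definition group_eqn_eval (G : groupType) n (s : n.-tuple G) k
    (x : 'I_k -> G) (w : group_eqn n k) : G :=
  (\prod_(l <- w) match l with
                  | inl v => signed (x v.1) v.2
                  | inr a => word_eval s a
                  end)%g.

Definition group_solution (G : groupType) n (s : n.-tuple G) k
    (S : seq (group_eqn n k)) (x : 'I_k -> G) : Prop :=
  forall w, w \in S -> group_eqn_eval s x w = 1%g.

Definition code_group_system n k (S : seq (group_eqn n k)) : nat :=
  code_pair k
    (code_seq (code_seq (code_sum (@code_letter k) (@code_word n))) S).

Definition group_diophantine_decidable (G : groupType) n (s : n.-tuple G) :
    Prop :=
  exists2 f, computable1 f &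
    forall k (S : seq (group_eqn n k)),
      f (code_group_system S) = 1%N <-> exists x, group_solution s S x.

(* Equations p = 0 over K(G): p is a sum of products of (non-commuting)        *)
(* variables and coefficients.                                                 *)
Definition galg_poly (K : fieldType) n k := seq (seq ('I_k + galg_expr K n)).

Definition galg_poly_eval (K : fieldType) (G : groupType) n (s : n.-tuple G) k
    (x : 'I_k -> galg K G) (p : galg_poly K n k) : galg K G :=
  \sum_(m <- p) \prod_(l <- m) match l with
                               | inl v => x v
                               | inr a => galg_eval s a
                               end.

Definition galg_solution (K : fieldType) (G : groupType) n (s : n.-tuple G) k
    (S : seq (galg_poly K n k)) (x : 'I_k -> galg K G) : Prop :=
  forall p, p \in S -> galg_poly_eval s x p = 0.

Definition width_at_most (K : fieldType) (G : groupType) k (m : nat)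
    (x : 'I_k -> galg K G) : Prop :=
  forall i, (width (x i) <= m)%N.

Definition code_galg_system (K : fieldType) (c : K -> nat) n k
    (S : seq (galg_poly K n k)) : nat :=
  code_pair k
    (code_seq (code_seq (code_seq
       (code_sum (@nat_of_ord k) (@code_galg K c n)))) S).

(* The algorithm answers 0 if there is no solution of width at most m, and     *)
(* otherwise the successor of a code of such a solution.                       *)
Definition bounded_width_diophantine_decidable (K : fieldType) (c : K -> nat)
    (G : groupType) n (s : n.-tuple G) : Prop :=
  exists2 f, computable2 f &
    forall k (S : seq (galg_poly K n k)) (m : nat),
      let answer := f (code_galg_system c S) m in
      (answer = 0%N /\
         ~ exists2 x, galg_solution s S x & width_at_most m x) \/
      (exists y : k.-tuple (galg_expr K n),
         let x i := galg_eval s (tnth y i) in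
         [/\ answer = (code_seq (@code_galg K c n) y).+1,
             galg_solution s S x & width_at_most m x]).

(* Main.v *)
(* A solution of width at most m can be written x_i = sum_(j < m) a_ij g_ij    *)
(* with unknowns a_ij in K and g_ij in G. Expanding the equations turns each   *)
(* of them into sum_t c_t w_t = 0, where c_t is a monomial in the a_ij and w_t *)
(* a word in the g_ij. Such a sum vanishes iff its terms can be coloured so    *)
(* that terms of the same colour have the same w_t and their c_t sum to zero:  *)
(* no inequation between the w_t of different colours is needed. Hence there   *)
(* is a solution iff, for one of finitely many colourings, a system over K and *)
(* a system over G are both solvable. A solution is then found by searching    *)
(* for constants b_i such that adding the equations x_i = b_i to the system    *)
(* keeps it solvable.                                                          *)
(* Conversely, a polynomial system over K has the same solvability over K(G),  *)
(* because of the augmentation K(G) -> K, and its solutions in K have width at *)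
(* most 1. A system over G is solvable iff it has a solution of width at most  *)
(* 1 in invertible elements of K(G): these are multiples a g of elements of G, *)
(* and dropping the scalars a maps solutions to solutions.                     *)
Require Import Defs.
From mathcomp Require Import all_boot all_order all_algebra.
From mathcomp Require finmap monalg mpoly.

Set Implicit Arguments.
Unset Strict Implicit.
Unset Printing Implicit Defensive.

(** * Recursive functions *)

(** Pad each unknown of width at most [m] with zero coefficients to a sum of exactly [m] monomials
    ([spread_surj]) and multiply out ([poly_expandE]). Each equation becomes a vanishing sum of
    terms, a term being a monomial in scalar unknowns placed at the value of a word in group
    unknowns. In a solution, the scalars of the terms whose words share a value sum to zero. Colour
    the terms by that value: the sums over colour classes form a polynomial system over K, and
    equating each word with a new unknown for its colour gives a system over G. Conversely, any
    colouring for which both systems are solvable gives a solution: each class vanishes by itself,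
    even if two colours happen to have the same value. As many colours as terms suffice, so finitely
    many colourings are tried. This is [has_narrow_solutionP].

    A solution of a solvable system is found by enumerating tuples of formal sums. Some tuple works
    because the generators reach all of G ([solvable_solves]), and a tuple is tested by the same
    decision procedure, applied to the system with the values imposed ([solvesP]). [computes_search]
    turns this into a recursive function.

    In the other direction, both problems embed in the bounded width problem with bound 1. For K,
    the augmentation sends solutions back to K ([has_narrow_field]).

    Recursiveness of these procedures is proved through [computes], which is closed under pairs,
    sums, case analysis and folds over lists; [computes_tac] applies these closure rules along the
    syntax of an algorithm. *)

Definition Rec n (f : seq nat -> nat) : Prop :=
  recursive (fun v : n.-tuple nat => f v).

(** Arguments are plain lists instead of tuples, which avoids dependent types; only the values on
    lists of length [n] matter. *)
Lemma RecE n (f g : seq nat -> nat) :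
  (forall v, size v = n -> f v = g v) -> Rec n f -> Rec n g.
Proof. by move=> fg; apply: rec_ext => v; rewrite fg ?size_tuple. Qed.

Lemma Rec_ext n (f g : seq nat -> nat) : f =1 g -> Rec n f -> Rec n g.
Proof. by move=> fg; apply: RecE. Qed.

Lemma Rec_nth n i : i < n -> Rec n (fun v => nth 0 v i).
Proof.
move=> lt_in; apply: rec_ext (rec_proj (Ordinal lt_in)) => v.
by rewrite (tnth_nth 0).
Qed.

Lemma Rec_comp m n (f : seq nat -> nat) (g : nat -> seq nat -> nat) :
  Rec m f -> (forall i, i < m -> Rec n (g i)) ->
  Rec n (fun v => f [seq g i v | i <- iota 0 m]).
Proof.
move=> cf cg; have := rec_comp cf (fun i : 'I_m => cg i (ltn_ord i)).
apply: rec_ext => v; congr f; rewrite /= -val_enum_ord -map_comp.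
by rewrite enumT.
Qed.

Lemma computable1E f : computable1 f <-> Rec 1 (fun v => f (nth 0 v 0)).
Proof.
by split; apply: rec_ext => v; rewrite /thead (tnth_nth 0).
Qed.

Lemma computable2E f :
  computable2 f <-> Rec 2 (fun v => f (nth 0 v 0) (nth 0 v 1)).
Proof. by split; apply: rec_ext => v; rewrite !(tnth_nth 0). Qed.

Lemma Rec_app1 n f g : computable1 f -> Rec n g -> Rec n (fun v => f (g v)).
Proof.
move=> /computable1E cf cg; apply: Rec_ext (Rec_comp (g := fun=> g) cf _) => //.
Qed.

Lemma Rec_app2 n f g h : computable2 f -> Rec n g -> Rec n h ->
  Rec n (fun v => f (g v) (h v)).
Proof.
move=> /computable2E cf cg ch.
apply: Rec_ext (Rec_comp (g := fun i => if i is 0 then g else h) cf _) => //.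
by case.
Qed.

Lemma Rec_const n a : Rec n (fun=> a).
Proof.
elim: a => [|a IHa].
  by have := Rec_comp (g := fun=> fun=> 0) (rec_zero : Rec 0 (fun=> 0)); apply.
apply: (@Rec_app1 n succn) => //; exact: rec_succ.
Qed.

Lemma computable2_app1 f g : computable1 f -> computable2 g ->
  computable2 (fun a b => f (g a b)).
Proof. by move=> cf /computable2E cg; apply/computable2E; apply: Rec_app1. Qed.

Lemma computable2_app2 f g h : computable2 f -> computable2 g ->
  computable2 h -> computable2 (fun a b => f (g a b) (h a b)).
Proof.
move=> cf /computable2E cg /computable2E ch.
by apply/computable2E; apply: Rec_app2.
Qed.

Lemma computable2_fst f : computable1 f -> computable2 (fun a _ => f a).
Proof.
move=> cf; apply/computable2E; apply: (Rec_app1 cf); exact: Rec_nth.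
Qed.

Lemma computable2_snd f : computable1 f -> computable2 (fun _ b => f b).
Proof.
move=> cf; apply/computable2E; apply: (Rec_app1 cf); exact: Rec_nth.
Qed.

Lemma Rec_behead2 n f : Rec n f -> Rec n.+2 (fun w => f (behead (behead w))).
Proof.
move=> cf; apply: (RecE _ (Rec_comp (g := fun i w => nth 0 w i.+2) cf _)).
  case=> [|a [|b v]] //= [<-]; congr f.
  by apply: (@eq_from_nth _ 0) => [|i]; rewrite size_map size_iota // => lt_i;
    rewrite (nth_map 0) ?size_iota // nth_iota.
by move=> i lt_in; apply: Rec_nth.
Qed.

(** The step receives the counter and the accumulator as the first two entries of its list, and the
    parameters as the rest. The recursion itself is on a list with one more head entry, the number
    of steps, which composition then fills with [h v]. *)
Lemma Rec_iteri n (h g : seq nat -> nat) (F : nat -> nat -> seq nat -> nat) :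
  Rec n h -> Rec n g ->
  Rec n.+2 (fun w => F (nth 0 w 0) (nth 0 w 1) (behead (behead w))) ->
  Rec n (fun v => iteri (h v) (fun i r => F i r v) (g v)).
Proof.
move=> ch cg cF; have := rec_prim cg cF => {cg cF} cI.
have {}cI : Rec n.+1 (fun w => iteri (nth 0 w 0)
    (fun i r => F i r (behead w)) (g (behead w))).
  by apply: rec_ext cI => w /=; rewrite /thead (tnth_nth 0).
apply: (RecE _ (Rec_comp
  (g := fun i v => if i is i'.+1 then nth 0 v i' else h v) cI _)).
  move=> v sz_v; rewrite /=.
  set t := [seq _ | i <- _]; suff -> : t = v by [].
  apply: (@eq_from_nth _ 0) => [|i]; rewrite size_map size_iota // => lt_i.
  by rewrite (nth_map 0) ?size_iota // nth_iota.
by case=> // i; rewrite ltnS => /Rec_nth.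
Qed.

Lemma Rec_mu n (f : nat -> seq nat -> bool)
    (ex0 : forall v, exists y, f y v) :
  Rec n.+1 (fun w => ~~ f (nth 0 w 0) (behead w)) ->
  Rec n (fun v => ex_minn (ex0 v)).
Proof.
move=> cf.
have ex0' (v : n.-tuple nat) : exists y,
    (~~ f (nth 0 [tuple of y :: v] 0) (behead [tuple of y :: v]) : nat) == 0.
  by have [y fy] := ex0 v; exists y; rewrite /= fy.
apply: rec_ext (rec_mu ex0' cf) => v.
case: ex_minnP => /= a; rewrite eqb0 negbK => fa min_a.
case: ex_minnP => b fb min_b; apply/eqP; rewrite eqn_leq min_b // min_a //.
by rewrite fb.
Qed.

Lemma computable1_mu (P : nat -> nat -> bool) (ex : forall v, exists y, P v y) :
  computable2 (fun v y => P v y) -> computable1 (fun v => ex_minn (ex v)).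
Proof.
move=> cP; apply/computable1E.
apply: (@Rec_mu 1 (fun y v => P (nth 0 v 0) y) (fun v => ex (nth 0 v 0))).
(* Negation of a truth value: any positive number of steps resets 1 to 0. *)
have cN : computable1 (fun b => 1 - b).
  apply/computable1E.
  apply: (@Rec_ext _ (fun v => iteri (nth 0 v 0) (fun _ _ => 0) 1)).
    by move=> v; case: (nth 0 v 0) => // a; rewrite subn1.
  by apply: (@Rec_iteri 1 _ _ (fun _ _ _ => 0));
    [exact: Rec_nth | exact: Rec_const | exact: Rec_const].
apply: (@RecE _ (fun w => 1 - P (nth 0 w 1) (nth 0 w 0))).
  by case=> [|a [|b []]] //=; case: (P b a).
apply: (Rec_app1 cN); apply: (@Rec_app2 _ (fun a b => P a b)) => //; exact: Rec_nth.
Qed.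

(** * Arithmetic and bounded search as recursive functions *)

Lemma computable1_id : computable1 id.
Proof. by apply/computable1E; apply: Rec_nth. Qed.

Lemma computable1_succ : computable1 succn.
Proof. exact: rec_succ. Qed.

Lemma computable2_iteri (h g : nat -> nat -> nat) F :
  computable2 h -> computable2 g ->
  Rec 4 (fun w => F (nth 0 w 0) (nth 0 w 1) (nth 0 w 2) (nth 0 w 3)) ->
  computable2 (fun a b => iteri (h a b) (fun i r => F i r a b) (g a b)).
Proof.
move=> /computable2E ch /computable2E cg cF; apply/computable2E.
apply: (@Rec_iteri 2 _ _ (fun i r v => F i r (nth 0 v 0) (nth 0 v 1))) => //.
by apply: RecE cF; case=> [|i [|r []]].
Qed.

(** The last counter value of an iteration of length [a.+1] is [a]. *)
Lemma computable1_pred : computable1 predn.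
Proof.
apply/computable1E.
apply: (@Rec_ext _ (fun v => iteri (nth 0 v 0) (fun i _ => i) 0)).
  by move=> v; case: (nth 0 v 0).
by apply: (@Rec_iteri 1 _ _ (fun i _ _ => i));
  [exact: Rec_nth | exact: Rec_const | exact: Rec_nth].
Qed.

Lemma computable2_iter f : computable1 f -> computable2 (fun i a => iter i f a).
Proof.
move=> cf; apply: (@rec_ext _ (fun v : 2.-tuple nat =>
  iteri (tnth v ord0) (fun _ => f) (tnth v ord_max))).
  by move=> v; elim: (tnth v ord0) => //= i ->.
apply: (@computable2_iteri (fun a _ => a) (fun _ b => b) (fun _ r _ _ => f r)).
- exact: computable2_fst computable1_id.
- exact: computable2_snd computable1_id.
by apply: (Rec_app1 cf); exact: Rec_nth.
Qed.

Lemma computable2_ext (f g : nat -> nat -> nat) :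
  f =2 g -> computable2 f -> computable2 g.
Proof. by move=> fg; apply: rec_ext => v. Qed.

Lemma computable1_ext (f g : nat -> nat) : f =1 g -> computable1 f -> computable1 g.
Proof. by move=> fg; apply: rec_ext => v. Qed.

Lemma computable2C f : computable2 f -> computable2 (fun a b => f b a).
Proof.
move=> cf; apply: (computable2_app2 cf).
  exact: computable2_snd computable1_id.
exact: computable2_fst computable1_id.
Qed.

Lemma computable1_diag f : computable2 f -> computable1 (fun a => f a a).
Proof.
by move=> cf; apply/computable1E; apply: (Rec_app2 cf); apply: Rec_nth.
Qed.

Lemma computable1_const a : computable1 (fun=> a).
Proof. exact: (Rec_const 1 a). Qed.

Lemma computable1_comp f g :
  computable1 f -> computable1 g -> computable1 (fun a => f (g a)).
Proof. by move=> cf /computable1E cg; apply/computable1E; apply: Rec_app1. Qed.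

Lemma computable1_app2 f g h : computable2 f -> computable1 g ->
  computable1 h -> computable1 (fun a => f (g a) (h a)).
Proof.
move=> cf /computable1E cg /computable1E ch; apply/computable1E.
exact: Rec_app2.
Qed.

Lemma computable2_add : computable2 addn.
Proof.
apply: computable2_ext (computable2_iter computable1_succ) => a b.
by rewrite iter_succn addnC.
Qed.

Lemma computable2_mul : computable2 muln.
Proof.
apply: (@computable2_ext (fun a b => iteri a (fun _ r => b + r) 0)).
  by move=> a b; elim: a => //= a ->.
apply: (@computable2_iteri (fun a _ => a) (fun _ _ => 0) (fun _ r _ b => b + r)).
- exact: computable2_fst computable1_id.
- exact: computable2_fst (computable1_const 0).
by apply: (Rec_app2 computable2_add); apply: Rec_nth.
Qed.

Lemma computable2_sub : computable2 subn.
Proof.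
apply: computable2_ext (computable2C (computable2_iter computable1_pred)) => a b.
by elim: b => [|b IHb]; rewrite ?subn0 //= IHb subnS.
Qed.

Lemma computable1_exp2 : computable1 (fun a => 2 ^ a).
Proof.
have cd : computable1 (fun a => a + a).
  exact: computable1_diag computable2_add.
apply: computable1_ext (computable1_app2 (computable2_iter cd)
  computable1_id (computable1_const 1)) => a.
by elim: a => //= a ->; rewrite addnn -mul2n expnS.
Qed.

Lemma computable1_eq0 : computable1 (fun a => a == 0).
Proof.
apply: computable1_ext (computable1_app2 computable2_sub
  (computable1_const 1) computable1_id).
by case=> // a; rewrite subSS sub0n.
Qed.

Lemma computable2_leq : computable2 (fun a b => a <= b).
Proof. exact: computable2_app1 computable1_eq0 computable2_sub. Qed.

Lemma computable2_eqn : computable2 (fun a b => a == b).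
Proof.
apply: computable2_ext (computable2_app2 computable2_mul computable2_leq
  (computable2C computable2_leq)) => a b.
by rewrite eqn_leq; case: (a <= b); case: (b <= a).
Qed.

Lemma computable2_or (P Q : nat -> nat -> bool) :
  computable2 (fun a b => P a b) -> computable2 (fun a b => Q a b) ->
  computable2 (fun a b => P a b || Q a b).
Proof.
move=> cP cQ; apply: computable2_ext (computable2_app2 computable2_leq
  (computable2_fst (computable1_const 1))
  (computable2_app2 computable2_add cP cQ)) => a b.
by case: (P a b); case: (Q a b).
Qed.

Lemma computable2_has (P : nat -> nat -> nat -> bool) h :
  computable2 h ->
  Rec 3 (fun w => P (nth 0 w 0) (nth 0 w 1) (nth 0 w 2)) ->
  computable2 (fun a b => has (fun i => P i a b) (iota 0 (h a b))).
Proof.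
move=> ch cP; apply: (@computable2_ext
  (fun a b => iteri (h a b) (fun i r => 1 <= P i a b + r) 0)).
  move=> a b; elim: (h a b) => // n IHn.
  rewrite -[n.+1 in RHS]addn1 iotaD has_cat /= IHn orbF add0n.
  by case: (P n a b); case: has.
apply: (@computable2_iteri h (fun _ _ => 0)
  (fun i r a b => 1 <= P i a b + r)) => //.
  exact: computable2_fst (computable1_const 0).
apply: (Rec_app2 computable2_leq); first exact: Rec_const.
apply: (Rec_app2 computable2_add); last exact: Rec_nth.
apply: (RecE _ (Rec_comp
  (g := fun i w => nth 0 w (if i is 0 then 0 else i.+1)) cP _)) => //.
by case=> [|[|[|]]] // _; apply: Rec_nth.
Qed.

(* [CodeSeq] makes nat the type of S-expressions: 0 is nil, [ncons a b] a cons *)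
(* cell, and a [code_seq] is a proper list.                                    *)
Definition ncons a b := 2 ^ a * b.*2.+1.
Definition nhead z := head 0 (CodeSeq.decode z).
Definition ntail z := CodeSeq.code (behead (CodeSeq.decode z)).

Lemma ncons_code a b : ncons a b = CodeSeq.code (a :: CodeSeq.decode b).
Proof. by rewrite /= CodeSeq.decodeK. Qed.

Lemma nheadK a b : nhead (ncons a b) = a.
Proof. by rewrite ncons_code /nhead CodeSeq.codeK. Qed.

Lemma ntailK a b : ntail (ncons a b) = b.
Proof. by rewrite ncons_code /ntail CodeSeq.codeK /= CodeSeq.decodeK. Qed.

Lemma ncons_eq0 a b : (ncons a b == 0) = false.
Proof. by rewrite muln_eq0 expn_eq0. Qed.

Lemma nhead_tail z : z != 0 -> ncons (nhead z) (ntail z) = z.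
Proof.
rewrite -{1}(CodeSeq.decodeK z) /nhead /ntail ncons_code CodeSeq.codeK.
by rewrite -[in RHS](CodeSeq.decodeK z); case: (CodeSeq.decode z).
Qed.

Lemma computable2_ncons : computable2 ncons.
Proof.
apply: computable2_ext (computable2_app2 computable2_mul
  (computable2_fst computable1_exp2) (computable2_snd
    (computable1_comp computable1_succ (computable1_diag computable2_add)))).
by move=> a b; rewrite addnn.
Qed.

Lemma ltn_ncons a b : (a < ncons a b) && (b < ncons a b).
Proof.
have := CodeSeq.ltn_code (a :: CodeSeq.decode b); rewrite -ncons_code => /andP[-> _].
have b_lt : b < b.*2.+1 by rewrite ltnS -addnn leq_addr.
by rewrite (leq_trans b_lt) // leq_pmull // expn_gt0.
Qed.


(** A component of a pairing function is found by minimization, the other component being bounded by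
    the code. The code 0 need not be a pair; there every candidate is accepted, so the search stops
    at 0, as [f] demands. *)
Lemma computable1_inverse (f : nat -> nat) (c : nat -> nat -> nat) :
  computable2 c -> f 0 = 0 ->
  (forall z, z != 0 -> exists2 b, b <= z & c (f z) b = z) ->
  (forall a b a' b', c a b = c a' b' -> a = a') -> computable1 f.
Proof.
move=> cc f0 fP c_inj.
pose P z a := (z == 0) || has (fun b => c a b == z) (iota 0 z.+1).
have ex z : exists a, P z a.
  exists (f z); rewrite /P; case: eqVneq => // /fP[b le_bz eq_z].
  by apply/hasP; exists b; rewrite ?mem_iota ?eq_z.
apply: (@computable1_ext (fun z => ex_minn (ex z))).
  move=> z; case: ex_minnP => a; case: (eqVneq z 0) => [-> _|z0].
    by rewrite f0 => /(_ 0 isT); rewrite leqn0 => /eqP.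
  rewrite {1}/P (negPf z0) => /hasP[b _ /eqP eq_z] _.
  by have [b' _] := fP z z0; rewrite -{2}eq_z => /c_inj.
apply: computable1_mu; apply: computable2_or.
  exact: computable2_fst computable1_eq0.
apply: (@computable2_has (fun b z a => c a b == z) (fun z _ => z.+1)).
  exact: computable2_fst computable1_succ.
apply: (Rec_app2 computable2_eqn); last exact: Rec_nth.
by apply: (Rec_app2 cc); apply: Rec_nth.
Qed.

Lemma computable1_nhead : computable1 nhead.
Proof.
apply: computable1_inverse computable2_ncons _ _ _ => // [z /nhead_tail eq_z|].
  exists (ntail z) => //; rewrite -{2}eq_z ltnW //.
  by case/andP: (ltn_ncons (nhead z) (ntail z)).
by move=> a b a' b' /(congr1 nhead); rewrite !nheadK.
Qed.

Lemma computable1_ntail : computable1 ntail.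
Proof.
apply: computable1_inverse (computable2C computable2_ncons) _ _ _ => //.
  move=> z /nhead_tail eq_z.
  exists (nhead z) => //; rewrite -{2}eq_z ltnW //.
  by case/andP: (ltn_ncons (nhead z) (ntail z)).
by move=> a b a' b' /(congr1 ntail); rewrite !ntailK.
Qed.

(** * Computability between coded types *)

(** As a type class, so that the code of a compound type is assembled from its shape; the instances
    unfold to the codes used in the statement. *)
Class coding (T : Type) := enc : T -> nat.

#[global] Instance nat_coding : coding nat := id.
#[global] Instance bool_coding : coding bool := nat_of_bool.
#[global] Instance ord_coding n : coding 'I_n := @nat_of_ord n.
#[global] Instance pair_coding A B (cA : coding A) (cB : coding B) :
  coding (A * B) := fun u => code_pair (enc u.1) (enc u.2).
#[global] Instance seq_coding A (cA : coding A) : coding (seq A) :=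
  code_seq enc.
#[global] Instance sum_coding A B (cA : coding A) (cB : coding B) :
  coding (A + B) := code_sum enc enc.
#[global] Instance word_coding n : coding (word n) := @code_word n.

(** Case analysis as a constant applied to its branches, a shape that a tactic can match. *)
Definition sum_elim A B D (f : A -> D) (g : B -> D) (u : A + B) : D :=
  match u with inl a => f a | inr b => g b end.

Definition npair a b := ncons a (ncons b 0).
Definition nfst z := nhead z.
Definition nsnd z := nhead (ntail z).

Lemma nfstK a b : nfst (npair a b) = a. Proof. exact: nheadK. Qed.
Lemma nsndK a b : nsnd (npair a b) = b.
Proof. by rewrite /nsnd ntailK nheadK. Qed.

Section Encodings.
Context (A B : Type) {cA : coding A} {cB : coding B}.

Lemma enc_pair (a : A) (b : B) : enc (a, b) = npair (enc a) (enc b).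
Proof. by []. Qed.

Lemma enc_nil : enc (Nil A) = 0. Proof. by []. Qed.

Lemma enc_cons (a : A) s : enc (a :: s) = ncons (enc a) (enc s).
Proof. by []. Qed.

Lemma enc_inl (a : A) : enc (inl a : A + B) = npair 0 (enc a).
Proof. by []. Qed.

Lemma enc_inr (b : B) : enc (inr b : A + B) = npair 1 (enc b).
Proof. by []. Qed.

Lemma enc_drop (s : seq A) i : iter i ntail (enc s) = enc (drop i s).
Proof.
have t0 : ntail 0 = 0 by [].
elim: i s => [|i IHi] s; first by rewrite drop0.
rewrite iterSr; case: s => [|a s] //=; last by rewrite enc_cons ntailK IHi.
by rewrite enc_nil t0; elim: (i) => //= j ->.
Qed.

(** Lets the code of a list serve as a number of steps sufficient to traverse it. *)
Lemma size_enc (s : seq A) : size s <= enc s.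
Proof.
elim: s => //= a s IHs; apply: leq_ltn_trans IHs _; rewrite enc_cons.
exact: (proj2 (andP (ltn_ncons _ _))).
Qed.

End Encodings.

(** [F] is unconstrained at numbers that are not codes. *)
Definition computes (A B : Type) {cA : coding A} {cB : coding B} (f : A -> B) :=
  exists2 F, computable1 F & forall a, F (enc a) = enc (f a).

(** Iterate a constant step [f v] times: no step leaves [g v], at least one gives [h v]. *)
Lemma Rec_if n f g h : Rec n f -> Rec n g -> Rec n h ->
  Rec n (fun v => if f v == 0 then g v else h v).
Proof.
move=> cf cg ch; apply: (@Rec_ext _ (fun v => iteri (f v) (fun _ _ => h v) (g v))).
  by move=> v; case: (f v).
by apply: (@Rec_iteri _ _ _ (fun _ _ v => h v)) => //; apply: Rec_behead2.
Qed.

Lemma computable2_npair : computable2 npair.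
Proof.
apply: (computable2_app2 computable2_ncons).
  exact: computable2_fst computable1_id.
apply: (computable2_app2 computable2_ncons).
  exact: computable2_snd computable1_id.
exact: computable2_fst (computable1_const 0).
Qed.

Lemma computable1_nsnd : computable1 nsnd.
Proof. exact: computable1_comp computable1_nhead computable1_ntail. Qed.

Section Computes.
Context (A B C D : Type).
Context {cA : coding A} {cB : coding B} {cC : coding C} {cD : coding D}.

Lemma computes_ext (f g : A -> B) : f =1 g -> computes f -> computes g.
Proof. by move=> fg [F cF eF]; exists F => // a; rewrite eF fg. Qed.

Lemma computes_comp (f : B -> D) (g : A -> B) :
  computes f -> computes g -> computes (fun a => f (g a)).
Proof.
move=> [F cF eF] [G cG eG]; exists (fun z => F (G z)) => [|a].
  exact: computable1_comp.
by rewrite eG eF.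
Qed.

Lemma computes_id : computes (fun a : A => a).
Proof. by exists id => //; exact: computable1_id. Qed.

Lemma computes_enc : computes (fun a : A => enc a).
Proof. by exists id => //; exact: computable1_id. Qed.

Lemma computes_const (b : B) : computes (fun _ : A => b).
Proof. by exists (fun=> enc b) => //; exact: computable1_const. Qed.

Lemma computes_pair (f : C -> A) (g : C -> B) :
  computes f -> computes g -> computes (fun x => (f x, g x)).
Proof.
move=> [F cF eF] [G cG eG]; exists (fun z => npair (F z) (G z)).
  exact: computable1_app2 computable2_npair cF cG.
by move=> x; rewrite eF eG enc_pair.
Qed.

Lemma computes_app (f : A -> B -> D) (g : C -> A) (h : C -> B) :
  computes (fun p : A * B => f p.1 p.2) -> computes g -> computes h ->
  computes (fun x => f (g x) (h x)).
Proof.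
move=> [F cF eF] [G cG eG] [H cH eH].
exists (fun z => F (npair (G z) (H z))).
  exact: computable1_comp cF (computable1_app2 computable2_npair cG cH).
by move=> x; rewrite eG eH -enc_pair eF.
Qed.

Lemma computes_fst (f : C -> A * B) : computes f -> computes (fun x => (f x).1).
Proof.
move=> [F cF eF]; exists (fun z => nfst (F z)).
  exact: computable1_comp computable1_nhead cF.
by move=> x; rewrite eF; case: (f x) => a b; rewrite enc_pair nfstK.
Qed.

Lemma computes_snd (f : C -> A * B) : computes f -> computes (fun x => (f x).2).
Proof.
move=> [F cF eF]; exists (fun z => nsnd (F z)).
  exact: computable1_comp computable1_nsnd cF.
by move=> x; rewrite eF; case: (f x) => a b; rewrite enc_pair nsndK.
Qed.

Lemma computes_cons (f : C -> A) (g : C -> seq A) :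
  computes f -> computes g -> computes (fun x => f x :: g x).
Proof.
move=> [F cF eF] [G cG eG]; exists (fun z => ncons (F z) (G z)).
  exact: computable1_app2 computable2_ncons cF cG.
by move=> x; rewrite eF eG enc_cons.
Qed.

Lemma computes_inl (f : C -> A) : computes f -> computes (fun x => inl B (f x)).
Proof.
move=> [F cF eF]; exists (fun z => npair 0 (F z)).
  exact: computable1_app2 computable2_npair (computable1_const 0) cF.
by move=> x; rewrite eF enc_inl.
Qed.

Lemma computes_inr (f : C -> B) : computes f -> computes (fun x => inr A (f x)).
Proof.
move=> [F cF eF]; exists (fun z => npair 1 (F z)).
  exact: computable1_app2 computable2_npair (computable1_const 1) cF.
by move=> x; rewrite eF enc_inr.
Qed.

Lemma computable1_if f g h :
  computable1 f -> computable1 g -> computable1 h ->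
  computable1 (fun z => if f z == 0 then g z else h z).
Proof.
move=> /computable1E cf /computable1E cg /computable1E ch.
by apply/computable1E; apply: Rec_if.
Qed.

Lemma computes_if (b : C -> bool) (f g : C -> A) :
  computes b -> computes f -> computes g ->
  computes (fun x => if b x then f x else g x).
Proof.
move=> [P cP eP] [F cF eF] [G cG eG].
exists (fun z => if P z == 0 then G z else F z); first exact: computable1_if.
by move=> x; rewrite eP eF eG; case: (b x).
Qed.

Lemma computes_match (u : C -> A + B) (f : C -> A -> D) (g : C -> B -> D) :
  computes u -> computes (fun p : C * A => f p.1 p.2) ->
  computes (fun p : C * B => g p.1 p.2) ->
  computes (fun x => sum_elim (f x) (g x) (u x)).
Proof.
move=> [U cU eU] [F cF eF] [G cG eG].
exists (fun z => if nfst (U z) == 0 then F (npair z (nsnd (U z)))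
                 else G (npair z (nsnd (U z)))).
  have cp := computable1_app2 computable2_npair computable1_id
    (computable1_comp computable1_nsnd cU).
  apply: computable1_if.
  - exact: computable1_comp computable1_nhead cU.
  - exact: computable1_comp cF cp.
  - exact: computable1_comp cG cp.
move=> x; rewrite eU; case: (u x) => [a|b].
  by rewrite enc_inl nfstK nsndK -(eF (x, a)).
by rewrite enc_inr nfstK nsndK -(eG (x, b)).
Qed.

Lemma computes_iteri (h : C -> nat) (b : C -> B) (f : C -> nat -> B -> B) :
  computes h -> computes b ->
  computes (fun p : C * (nat * B) => f p.1 p.2.1 p.2.2) ->
  computes (fun x => iteri (h x) (f x) (b x)).
Proof.
move=> [H cH eH] [G cG eG] [F cF eF].
exists (fun z => iteri (H z) (fun i r => F (npair z (npair i r))) (G z)).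
  apply/computable1E.
  apply: (@Rec_iteri 1 _ _ (fun i r v => F (npair (nth 0 v 0) (npair i r)))).
  - exact/computable1E.
  - exact/computable1E.
  apply: (Rec_app1 cF); apply: (Rec_app2 computable2_npair).
    by apply: (Rec_behead2 (f := fun v => nth 0 v 0)); apply: Rec_nth.
  by apply: (Rec_app2 computable2_npair); apply: Rec_nth.
move=> x; rewrite eH eG /enc /=; elim: (h x) => //= i ->.
exact: (eF (x, (i, _))).
Qed.

(* Primitive recursion runs upwards, so step [i] processes the tail of rank    *)
(* [N - i.+1], where the code [N] of the list is used as a bound on its size;  *)
(* tails beyond the end of the list are nil.                                   *)
Lemma computes_foldr (s : C -> seq A) (b : C -> B) (f : C -> A -> B -> B) :
  computes s -> computes b ->
  computes (fun p : C * (A * B) => f p.1 p.2.1 p.2.2) ->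
  computes (fun x => foldr (f x) (b x) (s x)).
Proof.
move=> [S cS eS] [G cG eG] [F cF eF].
pose t i v := iter (S (nth 0 v 0) - i.+1) ntail (S (nth 0 v 0)).
pose st i r v := if t i v == 0 then G (nth 0 v 0) else
  F (npair (nth 0 v 0) (npair (nhead (t i v)) r)).
exists (fun z => iteri (S z) (fun i r => st i r [:: z]) (G z)).
  apply/computable1E.
  apply: (@Rec_ext _ (fun v =>
    iteri (S (nth 0 v 0)) (fun i r => st i r v) (G (nth 0 v 0)))) => //.
  apply: (@Rec_iteri 1 _ _ st); try exact/computable1E.
  have c0 : Rec 3 (fun w => nth 0 (behead (behead w)) 0).
    by apply: (Rec_behead2 (f := fun v => nth 0 v 0)); apply: Rec_nth.
  have ct : Rec 3 (fun w => t (nth 0 w 0) (behead (behead w))).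
    apply: (Rec_app2 (computable2_iter computable1_ntail)).
      apply: (Rec_app2 computable2_sub); first exact: Rec_app1 cS c0.
      by apply: (Rec_app1 computable1_succ); apply: Rec_nth.
    exact: Rec_app1 cS c0.
  apply: Rec_if => //; first exact: Rec_app1.
  apply: (Rec_app1 cF); apply: (Rec_app2 computable2_npair) => //.
  apply: (Rec_app2 computable2_npair); last exact: Rec_nth.
  exact: Rec_app1 computable1_nhead ct.
move=> x; rewrite eS eG; set N := enc (s x).
(* Invariant: after [i] steps the accumulator codes the fold over the list without its first [N - i]
   entries. *)
have stE i : i <= N -> iteri i (fun i r => st i r [:: enc x]) (enc (b x)) =
    enc (foldr (f x) (b x) (drop (N - i) (s x))).
  elim: i => [_|i IHi lt_iN]; first by rewrite subn0 drop_oversize ?size_enc.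
  rewrite [LHS]/= IHi 1?ltnW // /st /t /= eS enc_drop.
  have -> : N - i = (N - i.+1).+1 by rewrite subnSK.
  rewrite -[in drop _.+1 _]add1n -drop_drop.
  case: (drop _ _) => [|a r]; first by rewrite enc_nil /= eG.
  rewrite enc_cons ncons_eq0 nheadK /= drop0.
  exact: (eF (x, (a, _))).
by rewrite stE // subnn drop0.
Qed.

End Computes.

Section ComputesNat.
Context (C : Type) {cC : coding C}.
Implicit Types f g : C -> nat.

Lemma computes_app1 h f :
  computable1 h -> computes f -> computes (fun x => h (f x)).
Proof. by move=> ch; apply: (@computes_comp _ nat nat) => //; exists h. Qed.

Lemma computes_app2 h f g : computable2 h -> computes f -> computes g ->
  computes (fun x => h (f x) (g x)).
Proof.
move=> ch [F cF eF] [G cG eG]; exists (fun z => h (F z) (G z)).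
  exact: computable1_app2.
by move=> x; rewrite eF eG.
Qed.

Lemma computes_succ f : computes f -> computes (fun x => (f x).+1).
Proof. exact: computes_app1 computable1_succ. Qed.

Lemma computes_add f g :
  computes f -> computes g -> computes (fun x => f x + g x).
Proof. exact: computes_app2 computable2_add. Qed.

Lemma computes_mul f g :
  computes f -> computes g -> computes (fun x => f x * g x).
Proof. exact: computes_app2 computable2_mul. Qed.

Lemma computes_eqn f g :
  computes f -> computes g -> computes (fun x => f x == g x).
Proof.
move=> cf cg; have [F cF eF] := computes_app2 computable2_eqn cf cg.
by exists F.
Qed.

Lemma computes_leq f g :
  computes f -> computes g -> computes (fun x => f x <= g x).
Proof.
move=> cf cg; have [F cF eF] := computes_app2 computable2_leq cf cg.
by exists F.
Qed.

Lemma computes_bool (b : C -> bool) : computes b -> computes (fun x => b x : nat).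
Proof. by case=> F; exists F. Qed.

Lemma computes_and (a b : C -> bool) :
  computes a -> computes b -> computes (fun x => a x && b x).
Proof. by move=> ca cb; apply: computes_if => //; apply: computes_const. Qed.

Lemma computes_neg (a : C -> bool) : computes a -> computes (fun x => ~~ a x).
Proof. by move=> ca; apply: computes_if => //; apply: computes_const. Qed.

Lemma computes_or (a b : C -> bool) :
  computes a -> computes b -> computes (fun x => a x || b x).
Proof. by move=> ca cb; apply: computes_if => //; apply: computes_const. Qed.

End ComputesNat.

(** * Syntax-directed proofs of computability *)

Ltac computes_seq_step := fail.

(** Picks the closure rule from the head of the function. Constant functions come first, so that
    closed subterms are not taken apart. The last branch is a hook, redefined below to handle list
    operations. *)
Ltac computes_step := match goal with
  | |- computes (fun _ => ?b) => apply: computes_const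
  | |- computes (fun x => x) => apply: computes_id
  | |- computes fst =>
      eapply (@computes_fst _ _ _ _ _ _ (fun x => x))
  | |- computes snd =>
      eapply (@computes_snd _ _ _ _ _ _ (fun x => x))
  | |- computes (fun x => (@?f x).1) =>
      eapply (@computes_fst _ _ _ _ _ _ f)
  | |- computes (fun x => (@?f x).2) =>
      eapply (@computes_snd _ _ _ _ _ _ f)
  | |- computes (fun x => (@?f x, @?g x)) =>
      apply (@computes_pair _ _ _ _ _ _ f g)
  | |- computes (fun x => @?f x :: @?g x) => apply (@computes_cons _ _ _ _ f g)
  | |- computes (fun x => inl (@?f x)) => apply (@computes_inl _ _ _ _ _ _ f)
  | |- computes (fun x => inr (@?f x)) => apply (@computes_inr _ _ _ _ _ _ f)
  | |- computes (fun x => (@?f x).+1) => apply (@computes_succ _ _ f)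
  | |- computes (fun x => @?f x + @?g x) => apply (@computes_add _ _ f g)
  | |- computes (fun x => @?f x * @?g x) => apply (@computes_mul _ _ f g)
  | |- computes (fun x => @?f x <= @?g x) => apply (@computes_leq _ _ f g)
  | |- computes (fun x =>
         @eq_op Datatypes_nat__canonical__eqtype_Equality (@?f x) (@?g x)) =>
      apply (@computes_eqn _ _ f g)
  | |- computes (fun x => @?f x && @?g x) => apply (@computes_and _ _ f g)
  | |- computes (fun x => @?f x || @?g x) => apply (@computes_or _ _ f g)
  | |- computes (fun x => ~~ @?f x) => apply (@computes_neg _ _ f)
  | |- computes (fun x => nat_of_bool (@?f x)) => apply (@computes_bool _ _ f)
  | |- computes (fun x => if _ then _ else _) => apply: computes_if
  | |- computes (fun x => sum_elim (@?f x) (@?g x) (@?u x)) =>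
      eapply (@computes_match _ _ _ _ _ _ _ _ u f g)
  | |- computes (fun x => foldr (@?f x) (@?b x) (@?s x)) =>
      eapply (@computes_foldr _ _ _ _ _ _ s b f)
  | |- computes (fun x => iteri (@?h x) (@?f x) (@?b x)) =>
      eapply (@computes_iteri _ _ _ _ h b f)
  | _ => computes_seq_step
  end.
Ltac computes_tac := repeat (cbv beta; first [assumption | computes_step]).

Section ComputesSeq.
Context (A B C : Type) {cA : coding A} {cB : coding B} {cC : coding C}.

Lemma computes_cat (s t : C -> seq A) :
  computes s -> computes t -> computes (fun x => s x ++ t x).
Proof.
move=> cs ct; apply: (@computes_ext _ _ _ _
  (fun x => foldr (fun a r => a :: r) (t x) (s x))).
  by move=> x; elim: (s x) => //= a r ->.
by computes_tac.
Qed.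

Lemma computes_map (s : C -> seq A) (f : C -> A -> B) :
  computes s -> computes (fun p : C * A => f p.1 p.2) ->
  computes (fun x => [seq f x a | a <- s x]).
Proof.
move=> cs cf; apply: (@computes_ext _ _ _ _
  (fun x => foldr (fun a r => f x a :: r) [::] (s x))).
  by move=> x; elim: (s x) => //= a r ->.
computes_tac.
by apply: (computes_app cf); computes_tac.
Qed.

End ComputesSeq.

Section ComputesSeqOps.
Context (A C : Type) {cA : coding A} {cC : coding C}.

Lemma computes_flatten (s : C -> seq (seq A)) :
  computes s -> computes (fun x => flatten (s x)).
Proof.
move=> cs; apply: computes_foldr => //; first exact: computes_const.
by eapply computes_cat; computes_tac.
Qed.

Lemma computes_filter (s : C -> seq A) (f : C -> A -> bool) :
  computes s -> computes (fun p : C * A => f p.1 p.2) ->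
  computes (fun x => [seq a <- s x | f x a]).
Proof.
move=> cs cf; apply: (@computes_ext _ _ _ _ (fun x =>
  foldr (fun a r => if f x a then a :: r else r) [::] (s x))).
  by move=> x; elim: (s x) => //= a r ->.
computes_tac.
by apply: (computes_app cf); computes_tac.
Qed.

Lemma computes_has (s : C -> seq A) (f : C -> A -> bool) :
  computes s -> computes (fun p : C * A => f p.1 p.2) ->
  computes (fun x => has (f x) (s x)).
Proof.
move=> cs cf; apply: (@computes_ext _ _ _ _ (fun x =>
  foldr (fun a r => f x a || r) false (s x))).
  by move=> x; elim: (s x) => //= a r ->.
computes_tac.
by apply: (computes_app cf); computes_tac.
Qed.

Lemma computes_all (s : C -> seq A) (f : C -> A -> bool) :
  computes s -> computes (fun p : C * A => f p.1 p.2) ->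
  computes (fun x => all (f x) (s x)).
Proof.
move=> cs cf; apply: (@computes_ext _ _ _ _ (fun x =>
  ~~ has (fun a => ~~ f x a) (s x))).
  by move=> x; rewrite -all_predC; apply: eq_all => a /=; rewrite negbK.
by apply: computes_neg; apply: computes_has => //; computes_tac.
Qed.

Lemma computes_size (s : C -> seq A) :
  computes s -> computes (fun x => size (s x)).
Proof.
move=> cs; apply: (@computes_ext _ _ _ _ (fun x =>
  foldr (fun a r => r.+1) 0 (s x))).
  by move=> x; elim: (s x) => //= a r ->.
by computes_tac.
Qed.

Lemma computes_nth (a : A) (s : C -> seq A) (i : C -> nat) :
  computes s -> computes i -> computes (fun x => nth a (s x) (i x)).
Proof.
move=> [S cS eS] [I cI eI].
pose t z := iter (I z) ntail (S z).
(* The code 0 of the remaining tail means that the index is past the end, hence the default. *)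
exists (fun z => if t z == 0 then enc a else nhead (t z)).
  have ct : computable1 t.
    exact: computable1_app2 (computable2_iter computable1_ntail) cI cS.
  apply: computable1_if => //; first exact: computable1_const.
  exact: computable1_comp computable1_nhead ct.
move=> x; rewrite /t eS eI enc_drop -[in RHS](addn0 (i x)) -nth_drop.
case: (drop _ _) => [|b r]; first by rewrite enc_nil.
by rewrite enc_cons ncons_eq0 nheadK.
Qed.

End ComputesSeqOps.

Lemma computes_iota C (cC : coding C) (m n : C -> nat) :
  computes m -> computes n -> computes (fun x => iota (m x) (n x)).
Proof.
move=> cm cn; apply: (@computes_ext _ _ _ _ (fun x =>
  iteri (n x) (fun i r => r ++ [:: m x + i]) [::])).
  move=> x; elim: (n x) => // i IHi.
  by rewrite -addn1 iotaD -IHi /= addn1.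
computes_tac; eapply computes_cat; computes_tac.
apply: (@computes_comp _ _ _ _ _ _ m (fun p : C * (nat * seq nat) => p.1)) => //.
by computes_tac.
Qed.

Ltac computes_expansion_step := fail.
Ltac computes_seq_step ::= match goal with
  | |- computes (fun x => [seq (@?f x) a | a <- @?s x]) =>
      eapply (@computes_map _ _ _ _ _ _ s f)
  | |- computes (fun x => map (@?f x) (@?s x)) =>
      eapply (@computes_map _ _ _ _ _ _ s f)
  | |- computes (fun x => filter (@?f x) (@?s x)) =>
      eapply (@computes_filter _ _ _ _ s f)
  | |- computes (fun x => has (@?f x) (@?s x)) =>
      eapply (@computes_has _ _ _ _ s f)
  | |- computes (fun x => all (@?f x) (@?s x)) =>
      eapply (@computes_all _ _ _ _ s f)
  | |- computes (fun x => size (@?s x)) =>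
      eapply (@computes_size _ _ _ _ s)
  | |- computes (fun x => flatten (@?s x)) =>
      eapply (@computes_flatten _ _ _ _ s)
  | |- computes (fun x => @?s x ++ @?t x) =>
      eapply (@computes_cat _ _ _ _ s t)
  | |- computes (fun x => iota (@?s x) (@?t x)) =>
      eapply (@computes_iota _ _ s t)
  | |- computes (fun x => nth ?a (@?s x) (@?i x)) =>
      eapply (@computes_nth _ _ _ _ a s i)
  | _ => computes_expansion_step
  end.

(** * Recognition of codes and unbounded search for witnesses *)

Lemma computes_nat (f : nat -> nat) : computes f -> computable1 f.
Proof. by move=> [F cF eF]; apply: computable1_ext cF. Qed.

(** A search through all natural numbers has to reject those that code nothing. *)
Definition decidable_image (T : Type) (cT : coding T) : Prop :=
  exists2 chi : nat -> bool, computable1 chi &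
    forall z, chi z <-> exists x : T, enc x = z.

Lemma decidable_image_nat : decidable_image nat_coding.
Proof.
exists (fun=> true) => [|z]; first exact: computable1_const.
by split => // _; exists z.
Qed.

Lemma decidable_image_bool : decidable_image bool_coding.
Proof.
exists (fun z => z <= 1) => [|z].
  exact: computable1_app2 computable2_leq computable1_id (computable1_const 1).
by split=> [|[[] <-]] //; case: z => [|[]] // _; [exists false | exists true].
Qed.

Lemma decidable_image_ord n : decidable_image (@ord_coding n).
Proof.
exists (fun z => z < n) => [|z].
  exact: computable1_app2 computable2_leq computable1_succ (computable1_const n).
by split=> [lt_zn|[i <-]]; [exists (Ordinal lt_zn) | apply: ltn_ord].
Qed.

Lemma computes_nfst : computes nfst.
Proof. by exists nfst => //; exact: computable1_nhead. Qed.

Lemma computes_nsnd : computes nsnd.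
Proof. by exists nsnd => //; exact: computable1_nsnd. Qed.

Lemma decidable_image_pair A B (cA : coding A) (cB : coding B) :
  decidable_image cA -> decidable_image cB ->
  decidable_image (pair_coding cA cB).
Proof.
move=> [a ca eA] [b cb eB].
exists (fun z => [&& a (nfst z), b (nsnd z) & z == npair (nfst z) (nsnd z)]).
  apply: (computes_nat (f := fun z => (_ : bool))).
  apply: computes_bool; apply: computes_and; [|apply: computes_and].
  - by apply: (@computes_comp _ nat bool) computes_nfst; exists a.
  - by apply: (@computes_comp _ nat bool) computes_nsnd; exists b.
  apply: computes_eqn; first exact: computes_id.
  exact: computes_app2 computable2_npair computes_nfst computes_nsnd.
move=> z; split=> [/and3P[/eA[x xz] /eB[y yz] /eqP->]|[[x y] <-]].
  by exists (x, y); rewrite enc_pair xz yz.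
rewrite enc_pair nfstK nsndK eqxx andbT; apply/andP; split.
  by apply/eA; exists x.
by apply/eB; exists y.
Qed.

Lemma decidable_image_seq A (cA : coding A) :
  decidable_image cA -> decidable_image (seq_coding cA).
Proof.
move=> [a ca eA]; exists (fun z => all a (CodeSeq.decode z)).
  apply: (computes_nat (f := fun z => (_ : bool))); apply: computes_bool.
  apply: (computes_all (f := fun=> a)).
    (* The list decoded from [z] has code [z], so decoding is computed by the identity. *)
    exists id => [|z]; first exact: computable1_id.
    by rewrite /enc /seq_coding /code_seq map_id CodeSeq.decodeK.
  have ca' : computes a by exists a.
  by apply: (computes_comp ca'); computes_tac.
move=> z; rewrite -{2}[z]CodeSeq.decodeK.
elim: (CodeSeq.decode z) => [|x s IHs]; first by split=> // _; exists [::].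
split=> [/= /andP[/eA[y yx] /IHs[t ts]]|[[|y t]]].
- by exists (y :: t); rewrite enc_cons yx ts.
- by move=> /eqP; rewrite enc_nil eq_sym [_ == _]ncons_eq0.
rewrite enc_cons => e; have yx := congr1 nhead e; have ts := congr1 ntail e.
rewrite !nheadK !ntailK in yx ts; rewrite /=; apply/andP; split.
  by apply/eA; exists y.
by apply/IHs; exists t.
Qed.

Lemma decidable_image_sum A B (cA : coding A) (cB : coding B) :
  decidable_image cA -> decidable_image cB ->
  decidable_image (sum_coding cA cB).
Proof.
move=> [a ca eA] [b cb eB].
exists (fun z => (z == npair (nfst z) (nsnd z)) &&
  (if nfst z == 0 then a (nsnd z) else (nfst z == 1) && b (nsnd z))).
  apply: (computes_nat (f := fun z => (_ : bool))).
  apply: computes_bool; apply: computes_and.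
    apply: computes_eqn; first exact: computes_id.
    exact: computes_app2 computable2_npair computes_nfst computes_nsnd.
  apply: computes_if.
  - by apply: computes_eqn computes_nfst _; exact: computes_const.
  - by apply: (@computes_comp _ nat bool) computes_nsnd; exists a.
  apply: computes_and.
  - by apply: computes_eqn computes_nfst _; exact: computes_const.
  - by apply: (@computes_comp _ nat bool) computes_nsnd; exists b.
move=> z; split=> [/andP[/eqP->]|[[x|y] <-]].
- rewrite nfstK nsndK; case: eqP => [-> /eA[x <-]|_ /andP[/eqP-> /eB[y <-]]].
    by exists (inl x).
  by exists (inr y).
- by rewrite enc_inl nfstK nsndK !eqxx; apply/eA; exists x.
by rewrite enc_inr nfstK nsndK !eqxx; apply/eB; exists y.
Qed.

Lemma decidable_image_word n : decidable_image (@word_coding n).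
Proof.
apply: (decidable_image_seq (cA := pair_coding (@ord_coding n) bool_coding)).
exact: decidable_image_pair (decidable_image_ord n) decidable_image_bool.
Qed.

(** Minimization over codes of [B] makes the existence of a witness effective. *)
Lemma computes_search A B (cA : coding A) (cB : coding B)
    (Q : A -> bool) (P : A -> B -> bool) :
  decidable_image cA -> decidable_image cB -> computes Q ->
  computes (fun p : A * B => P p.1 p.2) ->
  (forall a, Q a -> exists b, P a b) ->
  exists2 F, computable1 F &
    forall a, Q a -> exists2 b, F (enc a) = enc b & P a b.
Proof.
move=> [a ca eA] [b cb eB] [q cq eQ] [p cp eP] QP.
(* Minimization needs a search that always ends: where [v] is not the code of an input satisfying
   [Q], every [z] is accepted. *)
pose T v z := ~~ (a v && (0 < q v)) || (b z && (0 < p (npair v z))).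
have exT v : exists z, T v z.
  have [/andP[/eA[x <-]]|] := boolP (a v && (0 < q v)); last first.
    by move=> nv; exists 0; rewrite /T nv.
  rewrite eQ; case Qx: (Q x) => // _; have [y Pxy] := QP x Qx.
  exists (enc y); rewrite /T -enc_pair eP Pxy andbT.
  by apply/orP; right; apply/eB; exists y.
exists (fun v => ex_minn (exT v)).
  apply: computable1_mu.
  have cpos f : computable2 f -> computable2 (fun v z => 0 < f v z).
    move=> cf; apply: computable2_app2 computable2_leq _ cf.
    exact: computable2_fst (computable1_const 1).
  have cand (f g : nat -> nat -> bool) :
      computable2 (fun v z => f v z) -> computable2 (fun v z => g v z) ->
      computable2 (fun v z => f v z && g v z).
    move=> cf cg; apply: (@computable2_ext (fun v z => f v z * g v z)).
      by move=> v z; case: (f v z); case: (g v z).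
    exact: computable2_app2 computable2_mul cf cg.
  apply: computable2_or.
    apply: (@computable2_ext (fun v z => ((a v && (0 < q v)) : nat) == 0)).
      by move=> v z; case: (_ && _).
    apply: computable2_app1 computable1_eq0 _; apply: cand.
      exact: computable2_fst.
    by apply: (cpos (fun v _ => q v)); exact: computable2_fst.
  apply: cand; first exact: computable2_snd.
  by apply: cpos; exact: computable2_app1 cp computable2_npair.
move=> x Qx; case: ex_minnP => z; rewrite /T.
have -> : a (enc x) by apply/eA; exists x.
rewrite eQ Qx /= => /andP[/eB[y <-]]; rewrite -enc_pair eP => Pxy _.
by exists y => //; case: (P x y) Pxy.
Qed.

(** * Group algebra and expansion of equations *)

Import GRing.Theory.
Local Open Scope ring_scope.

(** * Distributivity and colourings of the terms of a system *)

Section Choices.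
Context (T : Type).

(** The cartesian product of a list of lists, which indexes the expansion of a product of sums. *)
Definition choices (ls : seq (seq T)) : seq (seq T) :=
  foldr (fun l r => flatten [seq [seq x :: c | c <- r] | x <- l]) [:: [::]] ls.

Lemma prod_sum_choices (R : nzRingType) (F : T -> R) ls :
  \prod_(l <- ls) \sum_(x <- l) F x =
  \sum_(c <- choices ls) \prod_(x <- c) F x.
Proof.
elim: ls => [|l ls IHls] /=; first by rewrite big_nil big_seq1 big_nil.
rewrite big_cons IHls big_flatten big_map mulr_suml; apply: eq_bigr => x _.
by rewrite big_map mulr_sumr; apply: eq_bigr => c _; rewrite big_cons.
Qed.

End Choices.

Lemma mem_choices (T : eqType) (ls : seq (seq T)) c :
  (c \in choices ls) = all2 (fun x l => x \in l) c ls.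
Proof.
elim: ls c => [|l ls IHls] c /=; first by rewrite inE; case: c.
apply/flatten_mapP/idP => [[x lx /mapP[d d_ls ->]]|].
  by rewrite /= lx -IHls.
case: c => //= x d /andP[lx]; rewrite -IHls => d_ls.
by exists x => //; apply: map_f.
Qed.

Lemma choices_map (S T : eqType) (f : S -> seq T) s c :
  reflect (c \in choices [seq f x | x <- s])
    (all2 (fun y x => y \in f x) c s).
Proof.
apply: (iffP idP); rewrite mem_choices.
  by elim: s c => [|x s IHs] [|y c] //= /andP[-> /IHs].
by elim: s c => [|x s IHs] [|y c] //= /andP[-> /IHs].
Qed.

Section Colorings.
Context (T : eqType).

(** All ways to attach a colour below [M] to every term of every equation. The colours are common to
    all equations. *)
Definition colorings (M : nat) (S : seq (seq T)) : seq (seq (seq (nat * T))) :=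
  choices [seq choices [seq [seq (j, t) | j <- iota 0 M] | t <- ts] | ts <- S].

Lemma coloringsP M S C :
  reflect ([seq [seq u.2 | u <- cs] | cs <- C] = S /\
           forall cs, cs \in C -> forall u, u \in cs -> (u.1 < M)%N)
          (C \in colorings M S).
Proof.
have col1 cs ts : reflect ([seq u.2 | u <- cs] = ts /\
      forall u, u \in cs -> (u.1 < M)%N)
    (cs \in choices [seq [seq (j, t) | j <- iota 0 M] | t <- ts]).
  apply: (iffP idP) => [|[<- lt_M]].
    move/choices_map; elim: ts cs => [|t ts IHts] [|u cs] //=.
    case/andP=> /mapP[j]; rewrite mem_iota add0n => /= lt_jM -> /IHts[<- lt_M].
    by split=> // v; rewrite inE => /predU1P[->|/lt_M].
  apply/choices_map; elim: cs lt_M => //= u cs IHcs lt_M.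
  rewrite IHcs ?andbT => [|v cs_v]; last by rewrite lt_M // inE cs_v orbT.
  apply/mapP; exists u.1; last by case: u {lt_M}.
  by rewrite mem_iota add0n lt_M ?mem_head.
apply: (iffP idP) => [|[<- lt_M]].
  move/choices_map; elim: S C => [|ts S IHS] [|cs C] //=.
  case/andP=> /col1[<- lt_M] /IHS[<- lt_MC].
  by split=> // ds; rewrite inE => /predU1P[->|/lt_MC].
apply/choices_map; elim: C lt_M => //= cs C IHC lt_M.
rewrite IHC ?andbT => [|ds Cds]; last by apply: lt_M; rewrite inE Cds orbT.
by apply/col1; split=> // u /lt_M -> //; apply: mem_head.
Qed.

End Colorings.

(** * Monomials, coefficients, width and augmentation in the group algebra *)

Section GroupAlgebraMonomials.
Import finmap monalg.
Local Open Scope fset_scope.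
Local Open Scope ring_scope.
Context (K : fieldType) (G : groupType).
Implicit Types (a b : K) (x y : G) (f g : galg K G).

Definition gmon a x : galg K G := << a *g x >>.

Lemma gmonM a b x y : gmon a x * gmon b y = gmon (a * b) (x * y)%g.
Proof. exact: gamulUU. Qed.

Lemma gmon1 : gmon 1 1%g = 1. Proof. by []. Qed.

Lemma gmon0 x : gmon 0 x = 0. Proof. exact: monalgU0. Qed.

Lemma gmonD a b x : gmon (a + b) x = gmon a x + gmon b x.
Proof. exact: monalgUD. Qed.

Lemma gmonN a x : gmon (- a) x = - gmon a x.
Proof. exact: monalgUN. Qed.

Lemma gmon_sum (I : Type) (r : seq I) (P : pred I) (F : I -> K) x :
  gmon (\sum_(i <- r | P i) F i) x = \sum_(i <- r | P i) gmon (F i) x.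
Proof. exact: (big_morph (gmon^~ x) (fun a b => gmonD a b x) (gmon0 x)). Qed.

Lemma gmon_prod (I : Type) (r : seq I) (F : I -> K) (w : I -> G) :
  \prod_(i <- r) gmon (F i) (w i) =
  gmon (\prod_(i <- r) F i) (\prod_(i <- r) w i)%g.
Proof.
elim: r => [|i r IHr]; first by rewrite !big_nil.
by rewrite !big_cons IHr gmonM.
Qed.

Definition gcoef x f : K := mcoeff x f.

Lemma gcoef0 x : gcoef x 0 = 0. Proof. exact: mcoeff0. Qed.

Lemma gcoefD x f g : gcoef x (f + g) = gcoef x f + gcoef x g.
Proof. exact: mcoeffD. Qed.

Lemma gcoef_gmon x a y : gcoef x (gmon a y) = a *+ (y == x).
Proof. exact: mcoeffU. Qed.

Lemma gcoef_sum (I : Type) (r : seq I) (F : I -> galg K G) x :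
  gcoef x (\sum_(i <- r) F i) = \sum_(i <- r) gcoef x (F i).
Proof. exact: (big_morph (gcoef x) (gcoefD x) (gcoef0 x)). Qed.

Definition gterms f : seq (K * G) := [seq (gcoef x f, x) | x <- msupp f].

Lemma gtermsE f : \sum_(t <- gterms f) gmon t.1 t.2 = f.
Proof. by rewrite big_map [RHS]monalgE. Qed.

Lemma size_gterms f : size (gterms f) = width f.
Proof. by rewrite size_map. Qed.

Lemma width_sum (I : Type) (r : seq I) (F : I -> galg K G) :
  (width (\sum_(i <- r) F i)%R <= \sum_(i <- r) width (F i))%N.
Proof.
apply: (big_ind2 (fun f m => width f <= m)%N) => // [|f a g b le_fa le_gb].
  by rewrite /width msupp0 cardfs0.
apply: leq_trans (leq_add le_fa le_gb).
apply: leq_trans (fsubset_leq_card (msuppD_le f g)) _.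
by rewrite cardfsU leq_subr.
Qed.

Lemma width_gmon a x : (width (gmon a x) <= 1)%N.
Proof.
by rewrite -(cardfs1 x); apply: fsubset_leq_card; apply: msuppU_le.
Qed.

(** The augmentation, the ring morphism to K that sends every group element to 1. *)
Definition aug f : K := \sum_(x <- msupp f) gcoef x f.

Lemma augw (d : {fset G}) f : msupp f `<=` d -> aug f = \sum_(x <- d) gcoef x f.
Proof.
by move=> le_d; apply: big_fset_incl => // x _ /mcoeff_outdom.
Qed.

Lemma aug0 : aug 0 = 0.
Proof. by rewrite /aug msupp0 big_seq_fset0. Qed.

Lemma augD f g : aug (f + g) = aug f + aug g.
Proof.
rewrite (augw (msuppD_le f g)) (augw (fsubsetUl (msupp f) (msupp g))).
rewrite (augw (fsubsetUr (msupp f) (msupp g))) -big_split /=.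
by apply: eq_bigr => x _; rewrite gcoefD.
Qed.

Lemma aug_gmon a x : aug (gmon a x) = a.
Proof. by rewrite (augw msuppU_le) big_seq_fset1 gcoef_gmon eqxx. Qed.

Lemma aug_sum (I : Type) (r : seq I) (F : I -> galg K G) :
  aug (\sum_(i <- r) F i) = \sum_(i <- r) aug (F i).
Proof. exact: (big_morph aug augD aug0). Qed.

Lemma augM f g : aug (f * g) = aug f * aug g.
Proof.
rewrite [f * g]/(gamul f g) /gamul aug_sum [aug f]/aug mulr_suml; apply: eq_bigr => x _.
rewrite aug_sum [aug g]/aug mulr_sumr; apply: eq_bigr => y _.
exact: aug_gmon.
Qed.

Lemma aug_prod (I : Type) (r : seq I) (F : I -> galg K G) :
  aug (\prod_(i <- r) F i) = \prod_(i <- r) aug (F i).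
Proof. exact: (big_morph aug augM (aug_gmon 1 1%g)). Qed.

End GroupAlgebraMonomials.

Section BigSeq.
Context (V : nmodType).

Lemma sum_by_label (I : eqType) (cs : seq I) (lab : I -> nat) (F : I -> V) M :
  (forall u, u \in cs -> (lab u < M)%N) ->
  \sum_(u <- cs) F u = \sum_(j <- iota 0 M) \sum_(u <- cs | lab u == j) F u.
Proof.
move=> lt_M; rewrite (exchange_big_dep xpredT) //=.
apply: eq_big_seq => u /lt_M lt_uM.
rewrite -big_filter (_ : filter _ _ = [:: lab u]) ?big_seq1 //.
rewrite (eq_filter (a2 := pred1 (lab u))) => [|j]; last exact: eq_sym.
by rewrite (filter_pred1_uniq (iota_uniq 0 M)) // mem_iota.
Qed.

(** Writes a sum of at most [m] terms with exactly [m] of them, the default contributing zero. *)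
Lemma sum_nth_pad (T : Type) (d : T) (F : T -> V) s m :
  F d = 0 -> (size s <= m)%N ->
  \sum_(j <- iota 0 m) F (nth d s j) = \sum_(t <- s) F t.
Proof.
move=> Fd le_sm; rewrite -(subnKC le_sm) iotaD big_cat /=.
rewrite -(big_map (nth d s) xpredT F) map_nth_iota0 // take_size.
rewrite [X in _ + X]big_seq [X in _ + X]big1 ?addr0 // => j.
by rewrite mem_iota add0n => /andP[le_sj _]; rewrite nth_default.
Qed.

End BigSeq.

(** Passes between a monomial given by its list of variables and one given by exponents. *)
Lemma prod_exp_count (R : comNzRingType) (f : nat -> R) vs k :
  all (fun v => v < k)%N vs ->
  \prod_(v <- iota 0 k) f v ^+ count_mem v vs = \prod_(v <- vs) f v.
Proof.
elim: vs => [|w vs IHvs] /=; first by rewrite big_nil big1.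
case/andP=> lt_wk /IHvs {IHvs} IHvs; rewrite big_cons -IHvs.
under eq_bigr => v _ do rewrite exprD.
rewrite big_split /=; congr (_ * _).
rewrite (bigD1_seq w) ?iota_uniq ?mem_iota //= eqxx expr1 big1 ?mulr1 // => v.
by rewrite eq_sym => /negPf->.
Qed.

(** * Expansion of equations into scalar monomials times words *)

Section Expansion.
Context (K : fieldType) (n : nat).

(** Variables are bare numbers, so that systems in any number of variables live in one coded type;
    [token_lt] states the bound separately. *)
Definition galg_token := (nat + galg_expr K n)%type.
Definition group_token := ((nat * bool) + word n)%type.

(* [((a, vs), w)] stands for the monomial of coefficient [a] times the product *)
(* of the field variables in [vs], at the group element [w].                   *)
Definition term := ((K * seq nat) * seq group_token)%type.

Definition token_lt k (t : galg_token) : bool :=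
  sum_elim (fun i => i < k)%N (fun=> true) t.

Definition group_token_lt k (t : group_token) : bool :=
  sum_elim (fun v => v.1 < k)%N (fun=> true) t.

Definition term_lt k (t : term) : bool :=
  all (fun v => v < k)%N t.1.2 && all (group_token_lt k) t.2.

Definition term_one : term := ((1, [::]), [::]).

Definition term_mul (t u : term) : term :=
  ((t.1.1 * u.1.1, t.1.2 ++ u.1.2), t.2 ++ u.2).

(* The unknown scalars and group elements of the [i]-th variable are those of  *)
(* indices [i * m, ..., i * m + m - 1].                                        *)
Definition token_expand m (t : galg_token) : seq term :=
  sum_elim
    (fun i => [seq ((1, [:: v]), [:: inl (v, false)]) | v <- iota (i * m) m])
    (fun e => [seq ((u.1, [::]), [:: inr u.2]) | u <- e]) t.

Definition poly_expand m (p : seq (seq galg_token)) : seq term :=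
  flatten [seq [seq foldr term_mul term_one c |
                  c <- choices [seq token_expand m t | t <- w]] | w <- p].

Lemma token_expand_lt m k t :
  token_lt k t -> all (term_lt (k * m)) (token_expand m t).
Proof.
case: t => [i|e] /= lt_ik; rewrite all_map; apply/allP => //= v.
rewrite mem_iota /term_lt /= !andbT andbb => /andP[_ lt_v].
by apply: leq_trans lt_v _; rewrite -mulSnr leq_mul2r lt_ik orbT.
Qed.

Lemma poly_expand_lt m k p :
  all (all (token_lt k)) p -> all (term_lt (k * m)) (poly_expand m p).
Proof.
move=> /allP lt_pk; apply/allP=> t /flatten_mapP[w pw /mapP[c c_w ->]].
have {lt_pk} /allP lt_wk := lt_pk w pw.
elim: w c {pw} lt_wk c_w => [|t' w IHw] c lt_wk /=.
  by rewrite inE => /eqP->.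
case/flatten_mapP=> u t'u /mapP[d d_w ->] /=.
have /allP/(_ u t'u)/andP[u1 u2] := token_expand_lt m (lt_wk t' (mem_head _ _)).
have /andP[d1 d2] : term_lt (k * m) (foldr term_mul term_one d).
  by apply: IHw d_w => v wv; rewrite lt_wk // inE wv orbT.
by rewrite /term_lt /= !all_cat u1 u2 d1 d2.
Qed.

Context (G : groupType) (s : n.-tuple G).

Definition token_poly_eval (x : nat -> galg K G) (p : seq (seq galg_token)) :
    galg K G :=
  \sum_(w <- p) \prod_(t <- w) sum_elim x (galg_eval s) t.

Definition token_word_eval (g : nat -> G) (w : seq group_token) : G :=
  (\prod_(t <- w) sum_elim (fun v => signed (g v.1) v.2) (word_eval s) t)%g.

Lemma token_word_eval_cat g w w' :
  token_word_eval g (w ++ w') = (token_word_eval g w * token_word_eval g w')%g.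
Proof. exact: big_cat. Qed.

Lemma token_word_eval1 g t : token_word_eval g [:: t] =
  sum_elim (fun v => signed (g v.1) v.2) (word_eval s) t.
Proof. exact: big_seq1. Qed.

Definition term_coef (al : nat -> K) (t : term) : K :=
  t.1.1 * \prod_(v <- t.1.2) al v.

Definition term_val (g : nat -> G) (t : term) : G := token_word_eval g t.2.

Lemma eq_term_val k g g' t : (forall v, v < k -> g v = g' v)%N ->
  term_lt k t -> term_val g t = term_val g' t.
Proof.
move=> eq_g /andP[_ /allP lt_k].
by apply: eq_big_seq => -[v|w] // /lt_k /eq_g /= ->.
Qed.

Lemma eq_token_poly_eval k x x' p : (forall i, i < k -> x i = x' i)%N ->
  all (all (token_lt k)) p -> token_poly_eval x p = token_poly_eval x' p.
Proof.
move=> eq_x /allP lt_p; apply: eq_big_seq => w /lt_p /allP lt_w.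
by apply: eq_big_seq => -[i|e] // /lt_w /eq_x.
Qed.

Definition term_mon al g (t : term) : galg K G :=
  gmon (term_coef al t) (term_val g t).

Lemma term_mon_foldr al g c :
  term_mon al g (foldr term_mul term_one c) = \prod_(t <- c) term_mon al g t.
Proof.
elim: c => [|t c IHc].
  rewrite big_nil /term_mon /term_coef /term_val /token_word_eval !big_nil.
  by rewrite mulr1.
rewrite big_cons -IHc gmonM /term_mon /term_coef /term_val /= big_cat.
by rewrite token_word_eval_cat mulrACA.
Qed.

Definition spread (al : nat -> K) (g : nat -> G) m (i : nat) : galg K G :=
  \sum_(v <- iota (i * m) m) gmon (al v) (g v).

(** Distributivity turns each product of sums into a sum over choices, and each choice is a product
    of monomials, hence a monomial. *)
Lemma poly_expandE al g m p :
  token_poly_eval (spread al g m) p =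
  \sum_(t <- poly_expand m p) term_mon al g t.
Proof.
rewrite big_flatten big_map; apply: eq_bigr => w _.
rewrite big_map; under [RHS]eq_bigr => c _ do rewrite term_mon_foldr.
rewrite -prod_sum_choices big_map; apply: eq_bigr => -[i|e] _ /=.
  rewrite big_map; apply: eq_bigr => v _.
  by rewrite /term_mon /term_coef /term_val token_word_eval1 big_seq1 mul1r.
rewrite big_map; apply: eq_bigr => u _.
by rewrite /term_mon /term_coef /term_val token_word_eval1 big_nil mulr1.
Qed.

Lemma width_spread al g m i : (width (spread al g m i) <= m)%N.
Proof.
apply: leq_trans (width_sum _ _) _.
rewrite -[leqRHS](size_iota (i * m) m) -sum1_size.
by apply: leq_sum => v _; apply: width_gmon.
Qed.

(** The unknown of index [v] belongs to variable [v %/ m] at position [v %% m]; past the support of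
    an element, the zero monomial is used. *)
Lemma spread_surj m k (x : nat -> galg K G) :
  (forall i, i < k -> width (x i) <= m)%N ->
  exists al g, forall i, (i < k)%N -> x i = spread al g m i.
Proof.
move=> le_m; pose t v := nth (0, 1%g) (gterms (x (v %/ m)%N)) (v %% m).
exists (fun v => (t v).1), (fun v => (t v).2) => i /le_m le_im.
rewrite -[LHS]gtermsE.
have <- := @sum_nth_pad _ _ (0, 1%g) (fun t => gmon t.1 t.2) (gterms (x i)) m.
- rewrite /spread -[(i * m)%N]addn0 iotaDl big_map.
  apply: eq_big_seq => j; rewrite mem_iota add0n => /= lt_jm.
  have m_gt0 := leq_ltn_trans (leq0n j) lt_jm.
  by rewrite /t divnMDl // divn_small // addn0 modnMDl modn_small.
- exact: gmon0.
by rewrite size_gterms.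
Qed.

End Expansion.

(** * Bounded width solvability reduced to systems over the field and the group *)

Section Decision.
Context (K : fieldType) (n : nat) (G : groupType) (s : n.-tuple G).
Notation term := (term K n).

Definition term_poly_eval k (al : nat -> K) (p : seq (K * seq nat)) : K :=
  \sum_(t <- p) t.1 * \prod_(v <- iota 0 k) al v ^+ nth 0%N t.2 v.

Definition exponents k (vs : seq nat) : seq nat :=
  [seq size [seq w <- vs | w == v] | v <- iota 0 k].

(** One equation for each equation of the given system and each colour: the scalars of that colour
    sum to zero. *)
Definition field_system k M (C : seq (seq (nat * term))) :
    seq (seq (K * seq nat)) :=
  flatten [seq [seq [seq (u.2.1.1, exponents k u.2.1.2) | u <- cs & u.1 == j]
    | j <- iota 0 M] | cs <- C].

(* Variable [k + j] stands for the common value of the words of colour [j],    *)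
(* and the flag [true] inverts it.                                             *)
Definition group_system k (C : seq (seq (nat * term))) :
    seq (seq (group_token n)) :=
  flatten [seq [seq u.2.2 ++ [:: inl ((k + u.1)%N, true)] | u <- cs] | cs <- C].

Lemma term_poly_eval_class k al (cs : seq (nat * term)) j :
  (forall u, u \in cs -> term_lt k u.2) ->
  term_poly_eval k al
    [seq (u.2.1.1, exponents k u.2.1.2) | u <- cs & u.1 == j] =
  \sum_(u <- cs | u.1 == j) term_coef al u.2.
Proof.
move=> lt_k; rewrite /term_poly_eval big_map big_filter.
rewrite big_seq_cond [RHS]big_seq_cond; apply: eq_bigr => u /andP[cu _].
congr (_ * _); have /andP[lt_u _] := lt_k u cu.
rewrite -(prod_exp_count al lt_u); apply: eq_big_seq => v.
rewrite mem_iota add0n => /= lt_vk.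
by rewrite (nth_map 0%N) ?size_iota // nth_iota // size_filter.
Qed.

Context (DK : nat * seq (seq (K * seq nat)) -> bool)
        (DG : nat * seq (seq (group_token n)) -> bool).

Hypothesis DKP : forall k P, all (all (fun t => size t.2 == k)) P ->
  DK (k, P) <-> exists al, forall p, p \in P -> term_poly_eval k al p = 0.
Hypothesis DGP : forall k P, all (all (group_token_lt k)) P ->
  DG (k, P) <-> exists g, forall w, w \in P -> token_word_eval s g w = 1%g.

Definition has_coloring k M (S : seq (seq term)) : bool :=
  has (fun C => DK (k, field_system k M C) && DG ((k + M)%N, group_system k C))
    (colorings M S).

(** The number of colours is the total number of terms, enough to give distinct word values distinct
    colours. *)
Definition has_narrow_solution k m (S : seq (seq (seq (galg_token K n)))) :
    bool :=
  has_coloring (k * m) (size (flatten [seq poly_expand m p | p <- S]))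
    [seq poly_expand m p | p <- S].

Lemma size_field_system k M C :
  all (all (fun t => size t.2 == k)) (field_system k M C).
Proof.
apply/allP=> p /flatten_mapP[cs _ /mapP[j _ ->]]; rewrite all_map.
by apply/allP=> u _ /=; rewrite size_map size_iota.
Qed.

Lemma group_system_lt k M (C : seq (seq (nat * term))) :
  (forall cs, cs \in C -> forall u, u \in cs -> (u.1 < M)%N && term_lt k u.2) ->
  all (all (group_token_lt (k + M))) (group_system k C).
Proof.
move=> lt_C; apply/allP=> w /flatten_mapP[cs Ccs /mapP[u cs_u ->]].
have /andP[lt_uM /andP[_ lt_u]] := lt_C cs Ccs u cs_u.
rewrite all_cat /= ltn_add2l lt_uM !andbT.
apply: sub_all lt_u => -[v|] //= lt_vk; exact: leq_trans lt_vk (leq_addr _ _).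
Qed.

(** Given solutions for a colouring, every colour class of every equation is a multiple of one group
    element, with scalar zero. Given a narrow solution, terms are coloured by the values of their
    words, and the field equations express that the coefficients of the equations vanish. *)
Lemma has_narrow_solutionP k m S : all (all (all (token_lt k))) S ->
  has_narrow_solution k m S <->
  exists2 x : nat -> galg K G, forall i, (i < k)%N -> (width (x i) <= m)%N &
    forall p, p \in S -> token_poly_eval s x p = 0.
Proof.
move=> lt_S; rewrite /has_narrow_solution /has_coloring.
set ts := [seq poly_expand m p | p <- S]; set M := size _; set km := (k * m)%N.
have lt_ts t : t \in flatten ts -> term_lt km t.
  case/flatten_mapP=> p Sp; apply/allP; apply: poly_expand_lt.
  exact: (allP lt_S).
split=> [/hasP[C /coloringsP[C_ts lt_C] /andP[]]|[x le_m x_S]].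
  have lt_Ckm cs u : cs \in C -> u \in cs -> term_lt km u.2.
    move=> Ccs cs_u; apply: lt_ts; rewrite -C_ts; apply/flattenP.
    by exists [seq u.2 | u <- cs]; apply: map_f.
  move/DKP=> /(_ (size_field_system _ _ _))[al al_C].
  move/DGP; case=> [|g g_C].
    by apply: group_system_lt => cs Ccs u cs_u; rewrite (lt_C cs) ?(lt_Ckm cs).
  exists (spread al g m) => [i _|p Sp]; first exact: width_spread.
  have /mapP[cs Ccs p_cs] : poly_expand m p \in [seq [seq u.2 | u <- cs] | cs <- C].
    by rewrite C_ts map_f.
  rewrite poly_expandE p_cs big_map.
  have val_u u : u \in cs -> term_val s g u.2 = g (km + u.1)%N.
    move=> cs_u; have : u.2.2 ++ [:: inl ((km + u.1)%N, true)] \in group_system km C.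
      by apply/flatten_mapP; exists cs => //; apply/mapP; exists u.
    move/g_C; rewrite token_word_eval_cat token_word_eval1.
    exact: divg1_eq.
  (* Sum colour by colour: in class [j] all words have the value [g (km + j)], so only the sum of
     the scalars counts. *)
  rewrite (@sum_by_label _ _ cs fst _ M); last exact: lt_C.
  rewrite big_seq big1 // => j; rewrite mem_iota add0n => /= lt_jM.
  transitivity (\sum_(u <- cs | u.1 == j) gmon (term_coef al u.2) (g (km + j)%N)).
    rewrite big_seq_cond [RHS]big_seq_cond; apply: eq_bigr => u.
    by case/andP=> cs_u /eqP<-; rewrite /term_mon val_u.
  rewrite -gmon_sum -(@term_poly_eval_class km) => [|u]; last exact: lt_Ckm.
  rewrite al_C ?gmon0 //; apply/flatten_mapP; exists cs => //.
  by apply/mapP; exists j; rewrite ?mem_iota.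
have [al [g xE]] := spread_surj le_m.
pose vals := [seq term_val s g t | t <- flatten ts].
(* First position of the value: terms have equal colours exactly when their words have equal
   values. *)
pose col (t : term) := index (term_val s g t) vals.
(* The variable of colour [j], of index [km + j], takes the [j]-th listed value. *)
pose gu v := if (v < km)%N then g v else nth 1%g vals (v - km).
have lt_col t : t \in flatten ts -> (col t < M)%N.
  by move=> t_ts; rewrite /M -(size_map (term_val s g)) /col index_mem map_f.
pose C := [seq [seq (col t, t) | t <- es] | es <- ts].
have C_ts : [seq [seq u.2 | u <- cs] | cs <- C] = ts.
  rewrite -map_comp -[RHS]map_id; apply: eq_map => es /=.
  by rewrite -map_comp map_id.
have C_col cs u : cs \in C -> u \in cs -> u.1 = col u.2 /\ u.2 \in flatten ts.
  case/mapP=> es ts_es -> /mapP[t es_t ->]; split=> //.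
  by apply/flattenP; exists es.
apply/hasP; exists C.
  apply/coloringsP; split=> // cs Ccs u /(C_col cs u Ccs)[-> ].
  exact: lt_col.
apply/andP; split.
  apply/DKP; first exact: size_field_system.
  exists al => q /flatten_mapP[cs Ccs /mapP[j]]; rewrite mem_iota add0n => /= lt_jM ->.
  rewrite term_poly_eval_class => [|u cs_u]; last first.
    by have [_ /lt_ts] := C_col _ _ Ccs cs_u.
  have /mapP[es /mapP[p Sp ->] cs_p] := Ccs.
  (* If position [j] repeats an earlier value, no term has colour [j] and the sum is empty. *)
  have [idx_j|idx_j] := eqVneq (index (nth 1%g vals j) vals) j; last first.
    rewrite big_seq_cond big_pred0 // => u.
    apply/negP => /andP[cs_u /eqP u_j]; case/eqP: idx_j.
    have [u_col u_ts] := C_col _ _ Ccs cs_u.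
    by rewrite -u_j u_col /col nth_index // map_f.
  (* Otherwise the sum is the coefficient of the vanishing equation at the [j]-th value. *)
  have := congr1 (gcoef (nth 1%g vals j)) (x_S p Sp).
  rewrite (eq_token_poly_eval s xE) ?(allP lt_S) // poly_expandE gcoef0 gcoef_sum => p_j.
  rewrite -[RHS]p_j {p_j}.
  rewrite cs_p big_map /= big_mkcond /=.
  apply: eq_big_seq => t p_t; rewrite gcoef_gmon.
  have t_ts : t \in flatten ts by apply/flatten_mapP; exists p.
  have -> : (col t == j) = (term_val s g t == nth 1%g vals j).
    by rewrite /col; apply/eqP/eqP => [<-|-> //]; rewrite nth_index // map_f.
  by case: eqP => _; rewrite ?mulr1n ?mulr0n.
apply/DGP.
  apply: group_system_lt => cs Ccs u cs_u; have [-> u_ts] := C_col _ _ Ccs cs_u.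
  by rewrite lt_col // lt_ts.
exists gu => w /flatten_mapP[cs Ccs /mapP[u cs_u ->]].
have [u_col u_ts] := C_col _ _ Ccs cs_u.
rewrite token_word_eval_cat token_word_eval1 /= -[token_word_eval _ _ _]/(term_val s gu u.2).
have -> : term_val s gu u.2 = term_val s g u.2.
  by apply: eq_term_val (lt_ts _ u_ts) => v lt_v; rewrite /gu lt_v.
rewrite {1}/gu ltnNge leq_addr addKn u_col nth_index ?map_f //=.
exact: mulgV.
Qed.

End Decision.

(** * Decision procedures *)

Lemma computes_choices T (cT : coding T) C (cC : coding C)
    (f : C -> seq (seq T)) :
  computes f -> computes (fun x => choices (f x)).
Proof. by move=> cf; rewrite /choices; computes_tac. Qed.

Section ComputesExpansion.
Context (K : fieldType) {cK : coding K} (n : nat).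
Hypothesis mulK : computes (fun p : K * K => p.1 * p.2).
Context (C : Type) {cC : coding C}.

Lemma computes_term_mul (f g : C -> term K n) :
  computes f -> computes g -> computes (fun x => term_mul (f x) (g x)).
Proof.
move=> cf cg; rewrite /term_mul; computes_tac.
by apply: (computes_app mulK); computes_tac.
Qed.

End ComputesExpansion.

Ltac computes_expansion_step ::= match goal with
  | |- computes (fun x => choices (@?f x)) =>
      eapply (@computes_choices _ _ _ _ f)
  | mulK : computes (fun p => p.1 * p.2)
    |- computes (fun x => term_mul (@?f x) (@?g x)) =>
      eapply (@computes_term_mul _ _ _ mulK _ _ f g)
  end.

Section ComputesDecision.
Context (K : fieldType) {cK : coding K} (n : nat).
Hypothesis mulK : computes (fun p : K * K => p.1 * p.2).

Lemma computes_token_expand :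
  computes (fun p : nat * galg_token K n => token_expand p.1 p.2).
Proof. by rewrite /token_expand; computes_tac. Qed.

Lemma computes_poly_expand : computes
  (fun p : nat * seq (seq (galg_token K n)) => poly_expand p.1 p.2).
Proof.
rewrite /poly_expand; computes_tac.
by apply: (computes_app computes_token_expand); computes_tac.
Qed.

Lemma computes_colorings : computes
  (fun p : nat * seq (seq (term K n)) => colorings p.1 p.2).
Proof. by rewrite /colorings; computes_tac. Qed.

Lemma computes_field_system : computes
  (fun p : (nat * nat) * seq (seq (nat * term K n)) =>
     field_system p.1.1 p.1.2 p.2).
Proof. by rewrite /field_system /exponents; computes_tac. Qed.

Lemma computes_group_system : computes
  (fun p : nat * seq (seq (nat * term K n)) => group_system p.1 p.2).
Proof. by rewrite /group_system; computes_tac. Qed.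

Lemma computes_has_narrow_solution
    (DK : nat * seq (seq (K * seq nat)) -> bool)
    (DG : nat * seq (seq (group_token n)) -> bool) :
  computes DK -> computes DG ->
  computes (fun p : (nat * nat) * seq (seq (seq (galg_token K n))) =>
    has_narrow_solution DK DG p.1.1 p.1.2 p.2).
Proof.
move=> cDK cDG.
have cE : computes (fun p : (nat * nat) * seq (seq (seq (galg_token K n))) =>
    [seq poly_expand p.1.2 q | q <- p.2]).
  by computes_tac; apply: (computes_app computes_poly_expand); computes_tac.
pose hc (u : (nat * nat) * seq (seq (term K n))) :=
  has_coloring DK DG u.1.1 u.1.2 u.2.
have chc : computes hc.
  rewrite /hc /has_coloring; computes_tac.
  - by apply: (computes_app computes_colorings); computes_tac.
  - apply: (computes_comp cDK); computes_tac.
    apply: (computes_comp computes_field_system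
      (g := fun p : (nat * nat) * _ * _ => (p.1.1, p.2))).
    by computes_tac.
  - apply: (computes_comp cDG); computes_tac.
    by apply: (computes_app computes_group_system); computes_tac.
apply: (computes_comp chc (g := fun p : (nat * nat) * _ =>
  ((p.1.1 * p.1.2, size (flatten [seq poly_expand p.1.2 q | q <- p.2])),
   [seq poly_expand p.1.2 q | q <- p.2])))%N.
by computes_tac.
Qed.

End ComputesDecision.

Lemma map_onto (A : Type) (B : eqType) (f : A -> B) (s : seq B) :
  (forall y, y \in s -> exists x, f x = y) -> exists t, map f t = s.
Proof.
elim: s => [|y s IHs] onto_s; first by exists [::].
have [x <-] := onto_s y (mem_head _ _).
have [z sz|t <-] := IHs; first by apply: onto_s; rewrite inE sz orbT.
by exists (x :: t).
Qed.

Lemma ord_extend (T : Type) (d : T) k (x : 'I_k -> T) :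
  exists y : nat -> T, forall i : 'I_k, y i = x i.
Proof.
by exists (fun v => if insub v is Some i then x i else d) => i; rewrite valK.
Qed.

Lemma code_seq_map (A B : Type) (cB : B -> nat) (f : A -> B) s :
  code_seq cB (map f s) = code_seq (cB \o f) s.
Proof. by rewrite /code_seq -map_comp. Qed.

Lemma eq_code_seq (A : Type) (f g : A -> nat) s :
  f =1 g -> code_seq f s = code_seq g s.
Proof. by move=> fg; rewrite /code_seq (eq_map fg). Qed.

(** * Systems with typed variables against systems with numbered variables *)

Section FieldSystems.
Import mpoly.
Context (K : fieldType) {cK : coding K}.

Definition exponent_terms k (p : mpoly_terms K k) : seq (K * seq nat) :=
  [seq (t.1, tval (multinom_val t.2)) | t <- p].

(** Bounds carried by types leave no trace in the code, so both forms of a system have the same code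
    and a decider for one serves for the other. *)
Lemma enc_exponent_terms k (S : seq (mpoly_terms K k)) :
  enc (k, map (@exponent_terms k) S) = code_field_system cK S.
Proof.
congr code_pair; rewrite {1}/enc /= /seq_coding code_seq_map.
apply: eq_code_seq => p /=; rewrite {1}/enc /= /seq_coding code_seq_map.
apply: eq_code_seq => t /=; congr code_pair.
by rewrite /enc /= /code_seq map_id.
Qed.

Lemma exponent_terms_onto k (P : seq (seq (K * seq nat))) :
  all (all (fun t => size t.2 == k)) P ->
  exists S, map (@exponent_terms k) S = P.
Proof.
move=> /allP size_P; apply: map_onto => p /size_P/allP size_p.
apply: map_onto => -[a e] /size_p /= size_e.
by exists (a, Multinom (Tuple size_e)).
Qed.

Lemma mpoly_of_termsE k (p : mpoly_terms K k) (al : nat -> K) x :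
  (forall i : 'I_k, al i = x i) ->
  (mpoly_of_terms p).@[x] = term_poly_eval k al (exponent_terms p).
Proof.
move=> al_x; rewrite /mpoly_of_terms raddf_sum /term_poly_eval big_map.
apply: eq_bigr => t _; rewrite /= mevalZ mevalX; congr (_ * _).
have -> : iota 0 k = index_iota 0 k by rewrite /index_iota subn0.
rewrite big_mkord.
by apply: eq_bigr => i _; rewrite al_x -(mnm_nth 0%N).
Qed.

Lemma field_solutionP k (S : seq (mpoly_terms K k)) (al : nat -> K) x :
  (forall i : 'I_k, al i = x i) ->
  field_solution S x <->
  forall p, p \in map (@exponent_terms k) S -> term_poly_eval k al p = 0.
Proof.
move=> al_x; split=> [sol _ /mapP[p Sp ->]|sol p Sp].
  by rewrite -(mpoly_of_termsE _ al_x) sol.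
by rewrite (mpoly_of_termsE _ al_x) sol // map_f.
Qed.

Definition field_decider (D : nat * seq (seq (K * seq nat)) -> bool) : Prop :=
  forall k P, all (all (fun t => size t.2 == k)) P ->
    D (k, P) <-> exists al, forall p, p \in P -> term_poly_eval k al p = 0.

Lemma field_diophantine_decidableP :
  field_diophantine_decidable cK <-> exists2 D, computes D & field_decider D.
Proof.
split=> [[f cf fP]|[D [f cf fD] DP]].
  exists (fun R => f (enc R) == 1%N).
    apply: computes_eqn; last exact: computes_const.
    by apply: computes_app1 cf _; exact: computes_enc.
  move=> k P /exponent_terms_onto[S <-]; rewrite enc_exponent_terms.
  split=> [/eqP/fP[x sol]|[al sol]].
    have [al al_x] := ord_extend 0 x.
    by exists al; apply/(field_solutionP _ al_x).
  apply/eqP/fP; exists (fun i => al i).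
  exact/(@field_solutionP _ _ al).
exists f => // k S; rewrite -enc_exponent_terms fD.
have eq1 (b : bool) : enc b = 1%N <-> b by case: b.
rewrite eq1 DP; last first.
  rewrite all_map; apply/allP=> p _ /=; rewrite all_map; apply/allP=> t _ /=.
  by rewrite size_tuple.
split=> [[al sol]|[x sol]].
  by exists (fun i => al i); exact/(@field_solutionP _ _ al).
have [al al_x] := ord_extend 0 x.
by exists al; apply/(field_solutionP _ al_x).
Qed.

End FieldSystems.

Section GroupSystems.
Context (G : groupType) (n : nat) (s : n.-tuple G).

Definition nat_letter k (t : 'I_k * bool + word n) : group_token n :=
  match t with
  | inl v => inl (nat_of_ord v.1, v.2)
  | inr w => inr w
  end.

Definition nat_group_eqn k (w : group_eqn n k) : seq (group_token n) :=
  map (@nat_letter k) w.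

Lemma enc_nat_group_eqn k (S : seq (group_eqn n k)) :
  enc (k, map (@nat_group_eqn k) S) = code_group_system S.
Proof.
congr code_pair; rewrite {1}/enc /= /seq_coding code_seq_map.
apply: eq_code_seq => p /=; rewrite {1}/enc /= /seq_coding code_seq_map.
by apply: eq_code_seq => -[].
Qed.

Lemma nat_group_eqn_onto k (P : seq (seq (group_token n))) :
  all (all (group_token_lt k)) P -> exists S, map (@nat_group_eqn k) S = P.
Proof.
move=> /allP lt_P; apply: map_onto => p /lt_P/allP lt_p.
apply: map_onto => -[[v b]|w] /lt_p /= lt_t; last by exists (inr w).
by exists (inl (Ordinal lt_t, b)).
Qed.

Lemma nat_group_eqn_lt k (S : seq (group_eqn n k)) :
  all (all (group_token_lt k)) (map (@nat_group_eqn k) S).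
Proof.
rewrite all_map; apply/allP=> p _ /=; rewrite all_map.
by apply/allP=> -[[v b]|w] _ //=.
Qed.

Lemma group_solutionP k (S : seq (group_eqn n k)) (g : nat -> G) x :
  (forall i : 'I_k, g i = x i) ->
  group_solution s S x <->
  forall w, w \in map (@nat_group_eqn k) S -> token_word_eval s g w = 1%g.
Proof.
move=> g_x.
have evalE w : token_word_eval s g (nat_group_eqn w) = group_eqn_eval s x w.
  rewrite /token_word_eval big_map; apply: eq_bigr => -[[v b]|u] _ //=.
  by rewrite g_x.
split=> [sol _ /mapP[w Sw ->]|sol w Sw]; first by rewrite evalE sol.
by rewrite -evalE sol // map_f.
Qed.

Definition group_decider (D : nat * seq (seq (group_token n)) -> bool) : Prop :=
  forall k P, all (all (group_token_lt k)) P ->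
    D (k, P) <-> exists g, forall w, w \in P -> token_word_eval s g w = 1%g.

Lemma group_diophantine_decidableP :
  group_diophantine_decidable s <-> exists2 D, computes D & group_decider D.
Proof.
split=> [[f cf fP]|[D [f cf fD] DP]].
  exists (fun R => f (enc R) == 1%N).
    apply: computes_eqn; last exact: computes_const.
    by apply: computes_app1 cf _; exact: computes_enc.
  move=> k P /nat_group_eqn_onto[S <-]; rewrite enc_nat_group_eqn.
  split=> [/eqP/fP[x sol]|[g sol]].
    have [g g_x] := ord_extend 1%g x.
    by exists g; apply/(group_solutionP _ g_x).
  apply/eqP/fP; exists (fun i => g i).
  exact/(@group_solutionP _ _ g).
exists f => // k S; rewrite -enc_nat_group_eqn fD.
have eq1 (b : bool) : enc b = 1%N <-> b by case: b.
rewrite eq1 DP ?nat_group_eqn_lt //.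
split=> [[g sol]|[x sol]].
  by exists (fun i => g i); exact/(@group_solutionP _ _ g).
have [g g_x] := ord_extend 1%g x.
by exists g; apply/(group_solutionP _ g_x).
Qed.

End GroupSystems.

Section AlgebraSystems.
Context (K : fieldType) {cK : coding K} (G : groupType) (n : nat).
Context (s : n.-tuple G).

Definition nat_token k (t : 'I_k + galg_expr K n) : galg_token K n :=
  match t with inl i => inl (nat_of_ord i) | inr e => inr e end.

Definition nat_galg_poly k (p : galg_poly K n k) : seq (seq (galg_token K n)) :=
  map (map (@nat_token k)) p.

Lemma enc_nat_galg_poly k (S : seq (galg_poly K n k)) :
  enc (k, map (@nat_galg_poly k) S) = code_galg_system cK S.
Proof.
congr code_pair; rewrite {1}/enc /= /seq_coding code_seq_map.
apply: eq_code_seq => p /=; rewrite {1}/enc /= /seq_coding code_seq_map.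
apply: eq_code_seq => w /=; rewrite {1}/enc /= /seq_coding code_seq_map.
by apply: eq_code_seq => -[].
Qed.

Lemma nat_galg_poly_onto k (P : seq (seq (seq (galg_token K n)))) :
  all (all (all (token_lt k))) P -> exists S, map (@nat_galg_poly k) S = P.
Proof.
move=> /allP lt_P; apply: map_onto => p /lt_P/allP lt_p.
apply: map_onto => w /lt_p/allP lt_w.
apply: map_onto => -[v|e] /lt_w /= lt_t; last by exists (inr e).
by exists (inl (Ordinal lt_t)).
Qed.

Lemma nat_galg_poly_lt k (S : seq (galg_poly K n k)) :
  all (all (all (token_lt k))) (map (@nat_galg_poly k) S).
Proof.
rewrite all_map; apply/allP=> p _ /=; rewrite all_map.
by apply/allP=> w _ /=; rewrite all_map; apply/allP=> -[v|e] _ //=.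
Qed.

Lemma galg_solutionP k (S : seq (galg_poly K n k)) (y : nat -> galg K G) x :
  (forall i : 'I_k, y i = x i) ->
  galg_solution s S x <->
  forall p, p \in map (@nat_galg_poly k) S -> token_poly_eval s y p = 0.
Proof.
move=> y_x.
have evalE p : token_poly_eval s y (nat_galg_poly p) = galg_poly_eval s x p.
  rewrite /token_poly_eval big_map; apply: eq_bigr => w _.
  by rewrite big_map; apply: eq_bigr => -[v|e] _ /=; rewrite ?y_x.
split=> [sol _ /mapP[p Sp ->]|sol p Sp]; first by rewrite evalE sol.
by rewrite -evalE sol // map_f.
Qed.

Definition has_narrow k m (P : seq (seq (seq (galg_token K n)))) : Prop :=
  exists2 y : nat -> galg K G, forall i, (i < k)%N -> (width (y i) <= m)%N &
    forall p, p \in P -> token_poly_eval s y p = 0.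

Lemma galg_narrowP k m (S : seq (galg_poly K n k)) :
  (exists2 x, galg_solution s S x & width_at_most m x) <->
  has_narrow k m (map (@nat_galg_poly k) S).
Proof.
split=> [[x sol le_m]|[y le_m sol]].
  have [y y_x] := ord_extend 0 x; exists y.
    by move=> i lt_ik; rewrite (y_x (Ordinal lt_ik)).
  exact/(galg_solutionP _ y_x).
exists (fun i => y i); last by move=> i; apply: le_m.
exact/(@galg_solutionP _ _ y).
Qed.

End AlgebraSystems.

(** * Testing candidate solutions *)

Section Main.
Context (K : fieldType) {cK : coding K} (G : groupType) (n : nat).
Context (s : n.-tuple G).

Lemma galg_eval_onto : generates s ->
  forall f : galg K G, exists e, galg_eval s e = f.
Proof.
move=> gen_s f.
have [|e def_e] := @map_onto (K * word n) _ (fun t => (t.1, word_eval s t.2)) (gterms f).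
  by move=> [a x] _; have [w <-] := gen_s x; exists (a, w).
exists e; rewrite -[RHS]gtermsE -def_e big_map.
by apply: eq_bigr.
Qed.

Lemma galg_eval1 a w : galg_eval s [:: (a, w)] = gmon a (word_eval s w) :> galg K G.
Proof. exact: big_seq1. Qed.

Lemma word_eval_nil : word_eval s [::] = 1%g.
Proof. exact: big_nil. Qed.

Lemma galg_eval_scalar a : galg_eval s [:: (a, [::])] = gmon a 1%g :> galg K G.
Proof. by rewrite galg_eval1 word_eval_nil. Qed.

Section Forward.
Context (DK : nat * seq (seq (K * seq nat)) -> bool)
        (DG : nat * seq (seq (group_token n)) -> bool).
Hypotheses (DKP : field_decider DK) (DGP : group_decider s DG).

Notation input := ((nat * seq (seq (seq (galg_token K n)))) * nat)%type.

Definition solvable (u : input) : bool :=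
  all (all (all (token_lt u.1.1))) u.1.2 &&
  has_narrow_solution DK DG u.1.1 u.2 u.1.2.

(** The equations [x_i - b_i = 0]; the scalar -1 is a formal sum on the empty word. *)
Definition fix_values k (b : seq (galg_expr K n)) :
    seq (seq (seq (galg_token K n))) :=
  [seq [:: [:: inl i]; [:: inr [:: (-1, [::])]; inr (nth [::] b i)]]
    | i <- iota 0 k].

(** Checking a candidate calls for deciding equality in K(G); imposing its values as extra equations
    reduces this to the solvability test. *)
Definition solves (u : input) (b : seq (galg_expr K n)) : bool :=
  (size b == u.1.1) &&
  has_narrow_solution DK DG u.1.1 u.2 (u.1.2 ++ fix_values u.1.1 b).

Lemma fix_values_lt k b : all (all (all (token_lt k))) (fix_values k b).
Proof.
rewrite all_map; apply/allP=> i; rewrite mem_iota add0n => /= lt_ik.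
by rewrite lt_ik.
Qed.

Lemma fix_valuesP k b (x : nat -> galg K G) :
  (forall p, p \in fix_values k b -> token_poly_eval s x p = 0) <->
  forall i, (i < k)%N -> x i = galg_eval s (nth [::] b i).
Proof.
have evalE i : token_poly_eval s x [:: [:: inl i];
    [:: inr [:: (-1, [::])]; inr (nth [::] b i)]] =
    x i - galg_eval s (nth [::] b i).
  rewrite /token_poly_eval !big_cons !big_nil addr0 !mulr1 /= galg_eval_scalar.
  by rewrite gmonN gmon1 mulN1r.
split=> [sol i lt_ik|sol p /mapP[i]].
  apply/eqP; rewrite -subr_eq0 -evalE sol // map_f //.
  by rewrite mem_iota.
by rewrite mem_iota add0n => /sol xi ->; rewrite evalE xi subrr.
Qed.

Lemma solvableP k P m : all (all (all (token_lt k))) P ->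
  solvable ((k, P), m) <-> has_narrow s k m P.
Proof.
by move=> lt_P; rewrite /solvable /= lt_P /=; apply: has_narrow_solutionP.
Qed.

Lemma solvesP k P m b : all (all (all (token_lt k))) P ->
  solves ((k, P), m) b <->
  [/\ size b = k,
      forall i, (i < k)%N -> (width (galg_eval s (nth [::] b i)) <= m)%N &
      forall p, p \in P ->
        token_poly_eval s (fun i => galg_eval s (nth [::] b i)) p = 0].
Proof.
move=> lt_P; rewrite /solves /=.
have /(has_narrow_solutionP DKP DGP m) sol :
    all (all (all (token_lt k))) (P ++ fix_values k b).
  by rewrite all_cat lt_P fix_values_lt.
split=> [/andP[/eqP sz_b /sol[x le_m x_sol]]|[sz_b le_m b_sol]].
  have x_b : forall i, (i < k)%N -> x i = galg_eval s (nth [::] b i).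
    by apply/fix_valuesP=> p pb; apply: x_sol; rewrite mem_cat pb orbT.
  split=> // [i lt_ik|p Pp]; first by rewrite -x_b ?le_m.
  rewrite -(eq_token_poly_eval s x_b) ?(allP lt_P) //.
  by rewrite x_sol // mem_cat Pp.
apply/andP; split; first exact/eqP.
apply/sol; exists (fun i => galg_eval s (nth [::] b i)) => // p.
rewrite mem_cat => /orP[/b_sol //|].
by apply: (proj2 (fix_valuesP k b _)).
Qed.

(** Generation allows the values of any solution to be written as formal sums, so the search for
    them ends. *)
Lemma solvable_solves u : generates s -> solvable u -> exists b, solves u b.
Proof.
case: u => -[k P] m gen_s sol_u.
have lt_P : all (all (all (token_lt k))) P by case/andP: sol_u.
have /(solvableP m lt_P)[x le_m x_sol] := sol_u.
have [f _|b def_b] := @map_onto _ _ (galg_eval s) [seq x i | i <- iota 0 k].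
  exact: galg_eval_onto.
have sz_b : size b = k by rewrite -(size_map (galg_eval s)) def_b size_map size_iota.
have x_b i : (i < k)%N -> x i = galg_eval s (nth [::] b i).
  move=> lt_ik; rewrite -(nth_map [::] 0) ?sz_b // def_b.
  by rewrite (nth_map 0%N) ?size_iota // nth_iota.
exists b; apply/solvesP => //; split=> // [i lt_ik|p Pp].
  by rewrite -x_b ?le_m.
by rewrite -(eq_token_poly_eval s x_b) ?(allP lt_P) // x_sol.
Qed.

End Forward.
End Main.

(** * Computing a solution from deciders for the field and the group *)

Section Theorem13.
Context (K : fieldType) {cK : coding K} (hK : computable_coding cK).
Context (G : groupType) (n : nat) (s : n.-tuple G).

Lemma computes_mulK : computes (fun p : K * K => p.1 * p.2).
Proof.
have [_ _ _ [mul cmul mulE]] := hK.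
exists (fun z => mul (nfst z) (nsnd z)).
  exact: computable1_app2 cmul computable1_nhead computable1_nsnd.
by case=> a b; rewrite enc_pair nfstK nsndK; apply: mulE.
Qed.

Lemma decidable_image_field : decidable_image cK.
Proof.
have [_ [chi cchi chiP] _ _] := hK.
exists (fun z => chi z == 1%N) => [|z]; last by split=> [/eqP/chiP|/chiP/eqP].
apply: (computes_nat (f := fun z => (_ : bool))); apply: computes_bool.
by apply: computes_eqn; [exists chi | exact: computes_const].
Qed.

Lemma bounded_width_of_diophantine : generates s ->
  field_diophantine_decidable cK -> group_diophantine_decidable s ->
  bounded_width_diophantine_decidable cK s.
Proof.
move=> gen_s /field_diophantine_decidableP[DK cDK DKP].
move=> /group_diophantine_decidableP[DG cDG DGP].
have mulK := computes_mulK.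
have cN := computes_has_narrow_solution mulK cDK cDG.
have cQ : computes (solvable DK DG).
  rewrite /solvable; computes_tac; first by rewrite /token_lt; computes_tac.
  apply: (computes_comp cN (g := fun u : nat * _ * nat =>
    ((u.1.1, u.2), u.1.2))).
  by computes_tac.
have cP : computes (fun p => solves DK DG p.1 p.2).
  rewrite /solves; computes_tac.
  apply: (computes_comp cN (g := fun p : (nat * _ * nat) * _ =>
    ((p.1.1.1, p.1.2), p.1.1.2 ++ fix_values p.1.1.1 p.2))).
  by rewrite /fix_values; computes_tac.
have dK := decidable_image_field.
have dE : decidable_image (@seq_coding _ (pair_coding cK (@word_coding n))).
  exact: decidable_image_seq (decidable_image_pair dK (@decidable_image_word n)).
(* Inputs are triples of a number of variables, a system and a width bound; the search is guarded by
   solvability, and its witnesses are lists of formal sums. *)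
have [F cF FP] := computes_search (decidable_image_pair (decidable_image_pair
    decidable_image_nat (decidable_image_seq (decidable_image_seq
      (decidable_image_seq (decidable_image_sum decidable_image_nat dE)))))
    decidable_image_nat) (decidable_image_seq dE) cQ cP
  (fun u => solvable_solves DKP DGP gen_s).
have [q cq qE] := cQ.
exists (fun z m => if q (npair z m) == 0%N then 0%N else (F (npair z m)).+1).
  have c1 : computable1 (fun z => if q z == 0%N then 0%N else (F z).+1).
    apply: computable1_if cq (computable1_const 0) _.
    exact: computable1_comp computable1_succ cF.
  exact: computable2_app1 c1 computable2_npair.
move=> k S m answer; pose P := map (@nat_galg_poly K n k) S.
have lt_P : all (all (all (token_lt k))) P := nat_galg_poly_lt S.
have inE : npair (code_galg_system cK S) m = enc ((k, P), m).
  by rewrite enc_pair enc_nat_galg_poly.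
have [sol|nsol] := boolP (solvable DK DG ((k, P), m)); last first.
  left; split; first by rewrite /answer inE qE (negPf nsol).
  by move=> /galg_narrowP/(solvableP DKP DGP m lt_P); apply/negP.
right; have [b Fb /(solvesP DKP DGP m b lt_P)[sz_b le_m b_sol]] := FP _ sol.
have/eqP sz_b' := sz_b; exists (Tuple sz_b') => x.
have b_x (i : 'I_k) : galg_eval s (nth [::] b i) = x i by rewrite /x (tnth_nth [::]).
split; last by move=> i; rewrite -b_x le_m.
- by rewrite /answer inE qE sol Fb.
exact: (proj2 (galg_solutionP s S b_x) b_sol).
Qed.

(** * Deciders for the field and the group from the bounded width problem *)

Lemma bounded_width_decider : bounded_width_diophantine_decidable cK s ->
  exists2 D : (nat * seq (seq (seq (galg_token K n)))) * nat -> bool,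
    computes D &
    forall k P m, all (all (all (token_lt k))) P ->
      D ((k, P), m) <-> has_narrow s k m P.
Proof.
case=> f cf fP; exists (fun u => ~~ (f (enc u.1) u.2 == 0%N)).
  apply: computes_neg; apply: computes_eqn; last exact: computes_const.
  apply: computes_app2 cf _ _; last by computes_tac.
  apply: (computes_comp
    (computes_enc (A := (nat * seq (seq (seq (galg_token K n))))%type))).
  by computes_tac.
move=> k P m /nat_galg_poly_onto[S <-] /=; rewrite enc_nat_galg_poly.
rewrite -galg_narrowP; case: (fP k S m) => [[-> nsol]|[y [-> sol le_m]]].
  by split.
by split=> // _; exists (fun i => galg_eval s (tnth y i)).
Qed.

(** Powers become repeated variables, and scalars become formal sums on the empty word. *)
Definition field_to_galg k (P : seq (seq (K * seq nat))) :
    seq (seq (seq (galg_token K n))) :=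
  [seq [seq inr [:: (t.1, [::])] ::
         flatten [seq [seq inl v | _ <- iota 0 (nth 0%N t.2 v)] | v <- iota 0 k]
       | t <- p] | p <- P].

Lemma field_to_galg_lt k P : all (all (all (token_lt k))) (field_to_galg k P).
Proof.
apply/allP=> _ /mapP[p _ ->]; apply/allP=> _ /mapP[t _ ->] /=.
apply/allP=> u /flatten_mapP[v]; rewrite mem_iota add0n => /= lt_vk.
by case/mapP=> j _ ->.
Qed.

Lemma field_to_galgE k (x : nat -> galg K G) p :
  token_poly_eval s x [seq inr [:: (t.1, [::])] ::
     flatten [seq [seq inl v | _ <- iota 0 (nth 0%N t.2 v)] | v <- iota 0 k]
       | t <- p] =
  \sum_(t <- p) gmon t.1 1%g * \prod_(v <- iota 0 k) x v ^+ nth 0%N t.2 v.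
Proof.
rewrite /token_poly_eval big_map; apply: eq_bigr => t _.
rewrite big_cons /= galg_eval_scalar big_flatten big_map; congr (_ * _).
apply: eq_bigr => v _; rewrite big_map /= big_const_seq count_predT size_iota.
by elim: (nth _ _ _) => //= e ->; rewrite exprS.
Qed.

(** The augmentation fixes the coefficients and maps any solution to one in K; conversely, scalars
    embed as multiples of the identity, of width at most 1. *)
Lemma has_narrow_field k P :
  has_narrow s k 1 (field_to_galg k P) <->
  exists al, forall p, p \in P -> term_poly_eval k al p = 0.
Proof.
split=> [[x _ sol]|[al sol]].
  exists (fun v => aug (x v)) => p Pp.
  have /(congr1 (@aug _ _)) := sol _ (map_f _ Pp).
  rewrite field_to_galgE aug0 aug_sum => <-; apply: eq_bigr => t _.
  rewrite augM aug_gmon aug_prod; congr (_ * _); apply: eq_bigr => v _.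
  by elim: (nth _ _ _) => [|e IHe]; rewrite ?expr0 ?exprS ?augM ?aug_gmon ?IHe.
exists (fun v => gmon (al v) 1%g) => [i _|_ /mapP[p Pp ->]].
  exact: width_gmon.
have gM a b : gmon (a * b) 1%g = gmon a 1%g * gmon b 1%g :> galg K G.
  by rewrite gmonM mulg1.
rewrite field_to_galgE -[RHS](gmon0 _ 1%g) -(sol p Pp) gmon_sum.
apply: eq_bigr => t _; rewrite gM; congr (_ * _).
elim: (iota 0 k) => [|v r IHr]; first by rewrite !big_nil.
rewrite !big_cons IHr gM; congr (_ * _).
by elim: (nth _ _ _) => [|e IHe]; rewrite ?expr0 // !exprS IHe gM.
Qed.

(* Variable [k + i] stands for the inverse of variable [i]. *)
Definition letter_to_galg k (t : group_token n) : galg_token K n :=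
  sum_elim (fun v => inl (if v.2 then k + v.1 else v.1)%N)
           (fun w => inr [:: (1, w)]) t.

Definition minus_one : seq (galg_token K n) := [:: inr [:: (-1, [::])]].

Definition group_to_galg k (P : seq (seq (group_token n))) :
    seq (seq (seq (galg_token K n))) :=
  [seq [:: [:: inl i; inl (k + i)%N]; minus_one] | i <- iota 0 k] ++
  [seq [:: [seq letter_to_galg k t | t <- w]; minus_one] | w <- P].

Lemma group_to_galg_lt k P : all (all (group_token_lt k)) P ->
  all (all (all (token_lt (k + k)))) (group_to_galg k P).
Proof.
move=> /allP lt_P; rewrite all_cat; apply/andP; split; apply/allP=> p /mapP[].
  move=> i; rewrite mem_iota add0n => /= lt_ik ->.
  by rewrite /= ltn_add2l lt_ik (leq_trans lt_ik) ?leq_addr.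
move=> w /lt_P lt_w -> /=; rewrite !andbT all_map.
apply: sub_all lt_w => -[[v []]|u] //= lt_vk; first by rewrite ltn_add2l.
exact: leq_trans lt_vk (leq_addr _ _).
Qed.

Lemma minus_oneE (x : nat -> galg K G) w :
  token_poly_eval s x [:: w; minus_one] = 0 <->
  \prod_(t <- w) sum_elim x (galg_eval s) t = 1.
Proof.
rewrite /token_poly_eval big_cons !big_seq1 /= galg_eval_scalar gmonN gmon1.
by split=> [/eqP|->]; rewrite ?subrr // subr_eq0 => /eqP.
Qed.

(** Otherwise the coefficient at the identity would be 0 instead of 1. *)
Lemma gmon_eq1 a (x : G) : gmon a x = 1 :> galg K G -> x = 1%g.
Proof.
move=> /(congr1 (gcoef 1%g)); rewrite -gmon1 !gcoef_gmon eqxx mulr1n.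
by case: eqP => // _ /eqP; rewrite mulr0n eq_sym oner_eq0.
Qed.

(** Width at most 1 makes every unknown a scalar times a group element. Each equation then says that
    a single monomial is 1, so its group part is 1 whatever the scalars are. Conversely, group
    elements and their inverses are taken with scalar 1. *)
Lemma has_narrow_group k P : all (all (group_token_lt k)) P ->
  has_narrow s (k + k) 1 (group_to_galg k P) <->
  exists g, forall w, w \in P -> token_word_eval s g w = 1%g.
Proof.
move=> lt_P; split=> [[x le_1 sol]|[g sol]].
  have [al [g xE]] := spread_surj le_1.
  have {}xE i : (i < k + k)%N -> x i = gmon (al i) (g i).
    by move=> /xE->; rewrite /spread muln1 big_seq1.
  (* One equation per variable suffices: its group part gives a right inverse, which in G is the
     inverse. *)
  have inv_g i : (i < k)%N -> g (k + i)%N = (g i)^-1%g.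
    move=> lt_ik; have : token_poly_eval s x [:: [:: inl i; inl (k + i)%N]; minus_one] = 0.
      by apply: sol; rewrite mem_cat map_f // mem_iota.
    move/minus_oneE; rewrite big_cons big_seq1 /= !xE ?ltn_add2l //; last first.
      exact: leq_trans lt_ik (leq_addr _ _).
    rewrite gmonM => /gmon_eq1 gg1.
    by rewrite -[LHS](mulKg (g i)) gg1 mulg1.
  exists g => w Pw.
  have : token_poly_eval s x [:: [seq letter_to_galg k t | t <- w]; minus_one] = 0.
    by apply: sol; rewrite mem_cat [X in _ || X]map_f ?orbT.
  move/minus_oneE; rewrite big_map.
  have -> : \prod_(t <- w) sum_elim x (galg_eval s) (letter_to_galg k t) =
      \prod_(t <- w) gmon
        (sum_elim (fun v => al (if v.2 then k + v.1 else v.1)%N) (fun=> 1) t)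
        (sum_elim (fun v => signed (g v.1) v.2) (word_eval s) t).
    apply: eq_big_seq => -[[v b]|u] wt /=; last by rewrite galg_eval1.
    have /= lt_vk := allP (allP lt_P w Pw) _ wt.
    case: b {wt} => /=; first by rewrite xE ?ltn_add2l // inv_g.
    by rewrite xE // (leq_trans lt_vk) ?leq_addr.
  by rewrite gmon_prod => /gmon_eq1.
(* Indices from [k] on hold the inverses of the first [k] values. *)
pose h v := if (v < k)%N then g v else (g (v - k)%N)^-1%g.
exists (fun v => gmon 1 (h v)) => [i _|p]; first exact: width_gmon.
rewrite mem_cat => /orP[/mapP[i]|/mapP[w Pw ->]].
  rewrite mem_iota add0n => /= lt_ik ->; apply/minus_oneE.
  rewrite big_cons big_seq1 /= gmonM mulr1 /h lt_ik ltnNge leq_addr /=.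
  by rewrite addKn mulgV.
apply/minus_oneE; rewrite big_map -[RHS]gmon1 -(sol w Pw).
have -> : \prod_(t <- w)
      sum_elim (fun v => gmon 1 (h v)) (galg_eval s) (letter_to_galg k t) =
    \prod_(t <- w)
      gmon 1 (sum_elim (fun v => signed (g v.1) v.2) (word_eval s) t).
  apply: eq_big_seq => -[[v b]|u] wt /=; last by rewrite galg_eval1.
  have /= lt_vk := allP (allP lt_P w Pw) _ wt.
  by case: b {wt}; rewrite /h /= ?lt_vk // ltnNge leq_addr addKn.
by rewrite gmon_prod big1.
Qed.

Lemma diophantine_of_bounded_width :
  bounded_width_diophantine_decidable cK s ->
  field_diophantine_decidable cK /\ group_diophantine_decidable s.
Proof.
case/bounded_width_decider=> D cD DP; split.
  apply/field_diophantine_decidableP.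
  exists (fun R => D ((R.1, field_to_galg R.1 R.2), 1%N)).
    by apply: (computes_comp cD); rewrite /field_to_galg; computes_tac.
  by move=> k P _; rewrite DP ?field_to_galg_lt // has_narrow_field.
apply/group_diophantine_decidableP.
exists (fun R => D ((R.1 + R.1, group_to_galg R.1 R.2), 1)%N).
  apply: (computes_comp cD); rewrite /group_to_galg /letter_to_galg.
  by computes_tac.
by move=> k P lt_P; rewrite DP ?group_to_galg_lt // has_narrow_group.
Qed.

End Theorem13.

Theorem theorem13 (K : fieldType) (c : K -> nat) (hK : computable_coding c)
    (G : groupType) (n : nat) (s : n.-tuple G) (hG : generates s) :
  bounded_width_diophantine_decidable c s <->
  field_diophantine_decidable c /\ group_diophantine_decidable s.
Proof.
split; first exact: diophantine_of_bounded_width.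
by case=> /(bounded_width_of_diophantine hK hG); apply.
Qed.
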